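(* Assume that $\log\log N=o(\log n)$, $\limsup\lambda_0<1$, and $I_{\lambda_0}^{-1}\log N\to\infty$. The largest connected component test (the test that rejects for large values of the number of nodes of the largest connected component of $\mathcal{G}$) is asymptotically powerful when $\liminf\lambda_1>1$, or when $$\lambda_0\le\lambda_1e^{1-\lambda_1}\ \text{ for } n \text{ large enough}\quad\text{and}\quad \liminf\ \frac{I_{\lambda_0}}{\lambda_0+I_{\lambda_1}-\lambda_0e^{I_{\lambda_1}}}\,\frac{\log n}{\log N}>1 .$$ If we further assume that $n^2=o(N)$, then the largest connected component test is asymptotically powerless when $\lambda_1<1$ for all $n$ and $$\lambda_0\ge\lambda_1e^{1-\lambda_1}\ \text{ for } n \text{ large enough}\quad\text{or}\quad \limsup\ \frac{I_{\lambda_0}}{\lambda_0+I_{\lambda_1}-\lambda_0e^{I_{\lambda_1}}}\,\frac{\log n}{\log N}<1 .$$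
   Context: Setting. We observe an undirected simple graph $\mathcal{G}$ on the node set $\mathcal{V}=\{1,\dots,N\}$ with adjacency matrix $(W_{i,j})$ (symmetric, $0/1$, zero diagonal). Under the null hypothesis, with distribution $\mathbb{P}_0$, $\mathcal{G}$ is an Erdős–Rényi graph $\mathbb{G}(N,p_0)$, i.e. the $W_{i,j}$, $i<j$, are i.i.d. Bernoulli($p_0$). For $S\subset\mathcal{V}$ with $|S|=n$, under $\mathbb{P}_S$ the $W_{i,j}$, $i<j$, are independent with $\mathbb{P}_S(W_{i,j}=1)=p_1$ if $i,j\in S$ and $=p_0$ otherwise, where $p_1>p_0$. The alternative is the union over all $S$ with $|S|=n$. The parameters $n,p_0,p_1$ may depend on $N$; all limits are as $N\to\infty$, with $n\to\infty$, $n/N\to0$, $n/\log N\to\infty$, $N^2p_0\to\infty$, $n^2p_1\to\infty$. Notation. $\lambda_0=Np_0$, $\lambda_1=np_1$, and $I_\lambda=\lambda-1-\log\lambda$ for $\lambda>0$. Tests. A test $\phi$ is a $\{0,1\}$-valued function of the adjacency matrix; its risk is $\gamma_N(\phi)=\mathbb{P}_0(\phi=1)+\max_{|S|=n}\mathbb{P}_S(\phi=0)$. The test that rejects for large values of a statistic $T$ is asymptotically powerful if there are critical values $t=t(N)$ (possibly depending on $p_1$) such that the risk of the test $\{T\ge t\}$ tends to $0$; it is asymptotically powerless if, for any sequence of reals $t=t(N)$, the risk of the test $\{T\ge t\}$ is at least $1$ in the limit. *)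

(* Defs.v *)
From HB Require Import structures.
From mathcomp Require Import all_boot all_order all_algebra.
From mathcomp Require Import all_classical all_reals all_analysis.

Set Implicit Arguments.
Unset Strict Implicit.
Unset Printing Implicit Defensive.

Import Order.TTheory GRing.Theory Num.Theory.
Import numFieldNormedType.Exports.

Local Open Scope ring_scope.

Definition is_adjacency (N : nat) (W : 'M[bool]_N) : bool :=
  [forall i, ~~ W i i] && [forall i, forall j, W i j == W j i].

(* The node set is {0, ..., N - 1}. *)
Definition sgraph (N : nat) := {W : 'M[bool]_N | is_adjacency W}.

Definition adj (N : nat) (G : sgraph N) : rel 'I_N := fun i j => val G i j.

Definition components (N : nat) (G : sgraph N) : {set {set 'I_N}} :=
  [set [set j | connect (adj G) i j] | i in [set: 'I_N]].

Definition largest_component (N : nat) (G : sgraph N) : nat :=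
  \max_(C in components G) #|C|.

(* Joint law of independent W_ij ~ Bernoulli(q i j), i < j; the remaining
   entries of the adjacency matrix are determined by symmetry. *)
Definition graph_pr (R : realType) (N : nat) (q : 'I_N -> 'I_N -> R)
    (A : pred (sgraph N)) : R :=
  \sum_(G : sgraph N | A G)
    \prod_(i < N) \prod_(j < N | (i < j)%N)
      (if adj G i j then q i j else 1 - q i j).

Definition null_pr (R : realType) (N : nat) (p0 : R) : pred (sgraph N) -> R :=
  graph_pr (fun _ _ => p0).

Definition planted_pr (R : realType) (N : nat) (p0 p1 : R) (S : {set 'I_N}) :
    pred (sgraph N) -> R :=
  graph_pr (fun i j => if (i \in S) && (j \in S) then p1 else p0).

(* The value true of phi stands for rejection.  The default value 0 of the
   maximum is harmless: probabilities are nonnegative, and there is a set S of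
   size n as soon as n <= N. *)
Definition risk (R : realType) (N n : nat) (p0 p1 : R)
    (phi : sgraph N -> bool) : R :=
  null_pr p0 phi +
  \big[Num.max/0]_(S : {set 'I_N} | #|S| == n)
     planted_pr p0 p1 S (fun G => ~~ phi G).

Local Open Scope classical_set_scope.

Definition asymptotically_powerful (R : realType) (n : nat -> nat)
    (p0 p1 : nat -> R) (T : forall N, sgraph N -> R) : Prop :=
  exists t : nat -> R,
    (fun N => risk (n N) (p0 N) (p1 N) (fun G : sgraph N => t N <= T N G))
      @ \oo --> (0 : R).

(* The limit inferior of the risk is at least 1; the risk need not converge. *)
Definition asymptotically_powerless (R : realType) (n : nat -> nat)
    (p0 p1 : nat -> R) (T : forall N, sgraph N -> R) : Prop :=
  forall t : nat -> R,
    (1%:E <= limn_einf (fun N =>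
       (risk (n N) (p0 N) (p1 N) (fun G : sgraph N => t N <= T N G))%:E))%E.

Definition rate (R : realType) (x : R) : R := x - 1 - ln x.

(* Extended-real valued because the denominator can vanish; the first quotient
   is then +oo (the inverse of 0 in \bar R).  When 0 < l0 < 1 and
   l0 <= l1 * expR (1 - l1), this happens exactly at l1 = 1, and +oo is the
   limit of the quotient there. *)
Definition threshold_ratio (R : realType) (l0 l1 : R) (N n : nat) : \bar R :=
  ((rate l0)%:E / (l0 + rate l1 - l0 * expR (rate l1))%:E
     * (ln n%:R / ln N%:R)%:E)%E.

(* Main.v *)
(** The component of a vertex is explored one vertex at a time; revealing the
    unexplored neighbours of an active vertex is independent of the past.

    Upper bounds: if z * \prod_x (1 + q(a,x) (y_x - 1)) <= y_a for all a, this
    recursion gives E z^|C(v)| <= y_v.  Under the null hypothesis y = 1 / l0 and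
    z = e^I(l0) give P(|C(v)| >= k) <= e^(- k I(l0)) / l0.  For a vertex v of the
    planted set S one takes different values of y inside and outside S; with
    x = l0 e^I(l1), the best rate is D = I(l1) + l0 - x if x <= 1 and I(l0)
    otherwise.

    Lower bounds: the same recursion gives the forest-counting lower bound on
    P(|C(v)| = k).  In the planted graph, one grows a tree of m vertices inside
    S and then a forest outside S rooted at it; the best choice k - m ~ k x gives
    P(|C(v)| >= k) >= e^(- k D) up to powers of k.  Exploring the components of
    about n / k^2 vertices of S one after the other, each of them succeeds with
    this probability given the past, so a component of size k exists with high probability as
    soon as n e^(- k D) beats the powers of k, i.e. for log n > (1 + eps) k D.
    The case l1 >= 1 reduces to l1 = 1, where D = 0, by a monotone coupling;
    log log N = o(log n) makes the powers of k harmless.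

    The test is powerful when (1 + eps) log N / I(l0) is a threshold separating
    the two laws.  It is powerless when the components that meet S have at most
    (1 - eps) log N / I(l0) vertices, which is less than the largest component of
    the null graph: the other components have the same law under both
    hypotheses. *)

Require Import Defs.
From HB Require Import structures.
From mathcomp Require Import all_boot all_order all_algebra.
From mathcomp Require Import all_classical all_reals all_analysis.
From mathcomp Require Import ring lra zify.
From mathcomp Require Import fintype finset.

Set Implicit Arguments.
Unset Strict Implicit.
Unset Printing Implicit Defensive.

Import Order.TTheory GRing.Theory Num.Theory.
Import numFieldNormedType.Exports.

Local Open Scope ring_scope.

(** * Products of Bernoulli laws *)

Lemma ler_eq (R : numDomainType) (x y : R) : x = y -> x <= y.
Proof. by move->. Qed.

Section BernoulliProduct.
Variables (R : realFieldType) (I : finType).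
Implicit Types (q : I -> R) (f g : {ffun I -> bool}).

Definition bern (p : R) (b : bool) : R := if b then p else 1 - p.

Definition bweight q f : R := \prod_i bern (q i) (f i).

Definition bexp q (F : {ffun I -> bool} -> R) : R := \sum_f bweight q f * F f.

Definition bprob q (E : pred {ffun I -> bool}) : R :=
  bexp q (fun f => (E f)%:R).

Definition is_prob q := forall i, 0 <= q i <= 1.

Lemma sum_bern p : \sum_(b : bool) bern p b = 1.
Proof. by rewrite big_bool /= addrC subrK. Qed.

Lemma bern_ge0 p b : 0 <= p <= 1 -> 0 <= bern p b.
Proof. by case/andP => p0 p1; case: b => //=; rewrite subr_ge0. Qed.

Lemma bweight_ge0 q f : is_prob q -> 0 <= bweight q f.
Proof. by move=> qP; apply: prodr_ge0 => i _; apply: bern_ge0. Qed.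

Lemma sum_bweight q : \sum_f bweight q f = 1.
Proof.
rewrite -(bigA_distr_bigA (fun i b => bern (q i) b)).
by rewrite big1 // => i _; exact: sum_bern.
Qed.

Lemma bexp_cst q c : bexp q (fun=> c) = c.
Proof. by rewrite /bexp -mulr_suml sum_bweight mul1r. Qed.

Lemma eq_bexp q F H : F =1 H -> bexp q F = bexp q H.
Proof. by move=> FH; apply: eq_bigr => f _; rewrite FH. Qed.

Lemma ler_bexp q F H : is_prob q -> (forall f, F f <= H f) ->
  bexp q F <= bexp q H.
Proof.
by move=> qP FH; apply: ler_sum => f _; apply: ler_wpM2l; rewrite ?bweight_ge0.
Qed.

Lemma bexp_ge0 q F : is_prob q -> (forall f, 0 <= F f) -> 0 <= bexp q F.
Proof. by move=> qP F0; rewrite -(bexp_cst q 0); apply: ler_bexp. Qed.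

Lemma bexp_sum (J : finType) (P : pred J) q (F : J -> {ffun I -> bool} -> R) :
  bexp q (fun f => \sum_(j | P j) F j f) = \sum_(j | P j) bexp q (F j).
Proof.
rewrite /bexp exchange_big /=; apply: eq_bigr => f _.
by rewrite mulr_sumr.
Qed.

Lemma bexpZ q c F : bexp q (fun f => c * F f) = c * bexp q F.
Proof. by rewrite /bexp mulr_sumr; apply: eq_bigr => f _; ring. Qed.

Lemma bexpD q F H : bexp q (fun f => F f + H f) = bexp q F + bexp q H.
Proof. by rewrite /bexp -big_split; apply: eq_bigr => f _; rewrite mulrDr. Qed.

Lemma bprob_ge0 q (E : pred {ffun I -> bool}) : is_prob q -> 0 <= bprob q E.
Proof. by move=> qP; apply: bexp_ge0. Qed.

Lemma le_bprob q (E F : pred {ffun I -> bool}) : is_prob q ->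
  (forall f, E f -> F f) -> bprob q E <= bprob q F.
Proof.
move=> qP EF; apply: ler_bexp => // f; rewrite ler_nat.
by case: (boolP (E f)) => [/EF ->|].
Qed.

Lemma bprob_le1 q (E : pred {ffun I -> bool}) : is_prob q -> bprob q E <= 1.
Proof.
move=> qP; rewrite -[leRHS](bexp_cst q); apply: ler_bexp => // f.
by rewrite lern1 leq_b1.
Qed.

Lemma bprobC q (E : pred {ffun I -> bool}) :
  bprob q (fun f => ~~ E f) = 1 - bprob q E.
Proof.
apply/eqP; rewrite eq_sym subr_eq -bexpD -[eqbLHS](bexp_cst q); apply/eqP.
by apply: eq_bexp => f; case: (E f); rewrite ?addr0 ?add0r.
Qed.

Lemma bprobU q (E F : pred {ffun I -> bool}) : is_prob q ->
  bprob q (fun f => E f || F f) <= bprob q E + bprob q F.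
Proof.
move=> qP; rewrite -bexpD; apply: ler_bexp => // f.
by rewrite -natrD ler_nat; case: (E f); case: (F f).
Qed.

Lemma bprob_exists (J : finType) (P : pred J) q
    (E : J -> pred {ffun I -> bool}) : is_prob q ->
  bprob q (fun f => [exists (j | P j), E j f]) <= \sum_(j | P j) bprob q (E j).
Proof.
move=> qP; rewrite -bexp_sum; apply: ler_bexp => // f.
case: existsP => [[j /andP[Pj Ej]]|_].
  by rewrite (bigD1 j) //= Ej lerDl sumr_ge0.
by apply: sumr_ge0.
Qed.

Definition mix (J : {set I}) f g : {ffun I -> bool} :=
  [ffun i => if i \in J then g i else f i].

Definition depends_on (J : {set I}) (T : Type) (F : {ffun I -> bool} -> T) :=
  forall f g, {in J, f =1 g} -> F f = F g.

Lemma depends_mix_in J T (F : _ -> T) f g : depends_on J F ->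
  F (mix J f g) = F g.
Proof. by move=> FJ; apply: FJ => i iJ; rewrite ffunE iJ. Qed.

Lemma depends_mix_out J T (F : _ -> T) f g : depends_on (~: J) F ->
  F (mix J f g) = F f.
Proof. by move=> FJ; apply: FJ => i; rewrite inE => /negbTE iJ; rewrite ffunE iJ. Qed.

(** Swapping the [J]-bits of two independent configurations is an involution, and it preserves the
    product weight because both laws agree on [J]. *)
Lemma sum_mix (J : {set I}) q q'
    (F : {ffun I -> bool} -> {ffun I -> bool} -> R) :
  {in J, q =1 q'} ->
  \sum_f \sum_g bweight q f * bweight q' g * F f g =
  \sum_f \sum_g bweight q f * bweight q' g * F (mix J f g) (mix J g f).
Proof.
move=> qq'; rewrite !pair_big /=.
rewrite (reindex (fun fg => (mix J fg.1 fg.2, mix J fg.2 fg.1))) /=.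
  apply: eq_bigr => -[f g] _ /=; congr (_ * _).
  rewrite /bweight -!big_split; apply: eq_bigr => i _ /=; rewrite !ffunE.
  by case: ifP => // iJ; rewrite qq' // mulrC.
apply: onW_bij; exists (fun fg => (mix J fg.1 fg.2, mix J fg.2 fg.1));
  by case=> f g /=; rewrite /mix; congr pair; apply/ffunP => i; rewrite !ffunE; case: (i \in J).
Qed.

(** The product of expectations is a double sum over [f] and [g]; after the swap of the [J]-bits
    both factors are read from [g], and the sum over [f] is 1. *)
Lemma bexp_indep (J : {set I}) q F H :
  depends_on J F -> depends_on (~: J) H ->
  bexp q (fun f => F f * H f) = bexp q F * bexp q H.
Proof.
move=> FJ HJ; rewrite /bexp mulr_suml.
under [RHS]eq_bigr do rewrite mulr_sumr.
transitivity (\sum_f \sum_g bweight q f * bweight q g * (F f * H g)); last first.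
  by apply: eq_bigr => f _; apply: eq_bigr => g _; ring.
rewrite (sum_mix (q' := q) _ (J := J)) // exchange_big /=.
apply: eq_bigr => g _.
under [RHS]eq_bigr do
  rewrite (depends_mix_in _ _ FJ) (depends_mix_out _ _ HJ) -mulrA.
by rewrite -mulr_suml sum_bweight mul1r.
Qed.

Lemma eq_bexp_on (J : {set I}) q q' F : {in J, q =1 q'} -> depends_on J F ->
  bexp q F = bexp q' F.
Proof.
move=> qq' FJ.
transitivity (\sum_f \sum_g bweight q f * bweight q' g * F f).
  apply: eq_bigr => f _; rewrite -mulr_suml -mulr_sumr sum_bweight.
  by rewrite mulr1.
rewrite (sum_mix (fun f g => F f) qq') exchange_big /=; apply: eq_bigr => g _.
under eq_bigr do rewrite (depends_mix_in _ _ FJ) -mulrA.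
by rewrite -mulr_suml sum_bweight mul1r.
Qed.

End BernoulliProduct.

(** Here [c i] is a joint weight on [T * U]; a product of its marginals becomes a sum over pairs of
    configurations, as a coupling requires. *)
Lemma sum_prod_fst (R : realFieldType) (I T U : finType) (c : I -> T -> U -> R)
    (F : {ffun I -> T} -> R) :
  \sum_(f : {ffun I -> T}) (\prod_i \sum_u c i (f i) u) * F f =
  \sum_(f : {ffun I -> T}) \sum_(g : {ffun I -> U})
     (\prod_i c i (f i) (g i)) * F f.
Proof.
by apply: eq_bigr => f _; rewrite bigA_distr_bigA mulr_suml.
Qed.

(* The law of a Bernoulli(p) variable below a Bernoulli(p') one, p <= p'. *)
Definition coupling_weight (R : realFieldType) (p p' : R) (b b' : bool) : R :=
  if b' then (if b then p else p' - p) else (if b then 0 else 1 - p').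

Lemma bexp_antimono (R : realFieldType) (I : finType) (q q' : I -> R)
    (F : {ffun I -> bool} -> R) :
  is_prob q -> is_prob q' -> (forall i, q i <= q' i) ->
  (forall f g : {ffun I -> bool}, (forall i, f i -> g i) -> F g <= F f) ->
  bexp q' F <= bexp q F.
Proof.
move=> qP q'P qq' Fmono.
pose c i := coupling_weight (q i) (q' i).
have -> : bexp q F = \sum_(f : {ffun I -> bool}) \sum_(g : {ffun I -> bool})
     (\prod_i c i (f i) (g i)) * F f.
  rewrite -sum_prod_fst; apply: eq_bigr => f _; congr (_ * _).
  apply: eq_bigr => i _; rewrite big_bool /c /coupling_weight /bern.
  by case: (f i) => /=; ring.
have -> : bexp q' F = \sum_(g : {ffun I -> bool}) \sum_(f : {ffun I -> bool})
     (\prod_i c i (f i) (g i)) * F g.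
  rewrite -(sum_prod_fst (fun i b b' => c i b' b)).
  apply: eq_bigr => f _; congr (_ * _).
  apply: eq_bigr => i _; rewrite big_bool /c /coupling_weight /bern.
  by case: (f i) => /=; ring.
rewrite exchange_big /=; apply: ler_sum => f _; apply: ler_sum => g _.
have [fg|] := boolP [forall i, f i ==> g i].
  apply: ler_wpM2l; last by apply: Fmono => i; apply/implyP/(forallP fg).
  apply: prodr_ge0 => i _; rewrite /c /coupling_weight.
  move: (qP i) (q'P i) (qq' i) => /andP[? ?] /andP[? ?] ?.
  by case: ifP; case: ifP; rewrite ?subr_ge0.
(* A bit set in [f] but not in [g] has weight 0 in the coupling. *)
rewrite negb_forall => /existsP[i]; rewrite negb_imply => /andP[fi gi].
by rewrite (bigD1 i) //= /c /coupling_weight fi (negbTE gi) !mul0r.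
Qed.

(** * Exploration of a graph *)

Section Reach.
Variable (V : finType).
Implicit Types (e : rel V) (A U W X C : {set V}).

(* The start vertices lie in A, all later vertices of a path lie in U. *)
Definition reach e A U : {set V} :=
  [set x | [exists a in A, connect [rel y z | e y z && (z \in U)] a x]].

Lemma reachP e A U x :
  reflect (exists2 a, a \in A & connect [rel y z | e y z && (z \in U)] a x)
          (x \in reach e A U).
Proof. by rewrite inE; exact: exists_inP. Qed.

Lemma sub_reach e A U : A \subset reach e A U.
Proof. by apply/subsetP => a aA; apply/reachP; exists a. Qed.

Lemma reach_step e A U y z :
  y \in reach e A U -> e y z -> z \in U -> z \in reach e A U.
Proof.
case/reachP => a aA ay yz zU; apply/reachP; exists a => //.
by apply: connect_trans ay (connect1 _); rewrite /= yz.
Qed.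

Lemma reach_min e A U X : A \subset X ->
  (forall y z, y \in X -> e y z -> z \in U -> z \in X) -> reach e A U \subset X.
Proof.
move=> AX Xstep; apply/subsetP => x /reachP[a aA /connectP[p]].
elim: p a {aA}(subsetP AX a aA) => [|z p IHp] a aX /=; first by move=> _ ->.
by case/andP => /andP[az zU] pz xE; apply: IHp pz xE; apply: Xstep az zU.
Qed.

Lemma reach_subU e A U : reach e A U \subset A :|: U.
Proof.
apply: reach_min => [|y z _ _ zU]; first exact: subsetUl.
by rewrite inE zU orbT.
Qed.

Lemma reach_mono e e' A A' U U' : A \subset A' -> U \subset U' ->
  (forall y z, e y z -> e' y z) -> reach e A U \subset reach e' A' U'.
Proof.
move=> AA' UU' ee'; apply: reach_min => [|y z yR yz zU].
  exact: subset_trans AA' (sub_reach _ _ _).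
by apply: reach_step yR (ee' _ _ yz) (subsetP UU' z zU).
Qed.

Lemma reach_trans e A U W :
  reach e (reach e A U) W \subset reach e A (U :|: W).
Proof.
apply: reach_min => [|y z yR yz zW].
  by apply: reach_mono => //; exact: subsetUl.
by apply: reach_step yR yz _; rewrite inE zW orbT.
Qed.

Lemma reach_explore e A U a : a \in A ->
  let B := [set x in U | e a x] in
  reach e A U = a |: reach e ((A :\ a) :|: B) (U :\: B).
Proof.
move=> aA B; apply/eqP; rewrite eqEsubset; apply/andP; split.
  apply: reach_min => [|y z].
    apply/subsetP => x xA; rewrite in_setU1; case: eqVneq => //= xa.
    by apply/(subsetP (sub_reach _ _ _)); rewrite !inE xa xA.
  rewrite in_setU1 => /orP yR yz zU; rewrite in_setU1; apply/orP; right.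
  have [zB|zB] := boolP (z \in B).
    by apply/(subsetP (sub_reach _ _ _)); rewrite inE zB orbT.
  case: yR => [/eqP ya|yR]; last by apply: reach_step yR yz _; rewrite inE zB.
  by case/negP: zB; rewrite inE zU -ya.
have aR : a \in reach e A U by exact: (subsetP (sub_reach _ _ _)).
rewrite subUset sub1set aR /=; apply: reach_min => [|y z yR yz].
  rewrite subUset (subset_trans (subsetDl _ _) (sub_reach _ _ _)) /=.
  by apply/subsetP => x; rewrite inE => /andP[xU ax]; exact: reach_step aR ax xU.
by rewrite inE => /andP[_ zU]; exact: reach_step yR yz zU.
Qed.

Lemma card_reach_explore e A U a : a \in A -> [disjoint A & U] ->
  let B := [set x in U | e a x] in
  #|reach e A U| = #|reach e ((A :\ a) :|: B) (U :\: B)|.+1.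
Proof.
move=> aA AU B; rewrite (reach_explore _ _ aA) -/B cardsU1.
suff -> : a \notin reach e ((A :\ a) :|: B) (U :\: B) by [].
apply: contraL aA => /(subsetP (reach_subU _ _ _)) aR.
have aU : a \in U.
  by move: aR; rewrite !inE eqxx /=; case/orP => /andP[].
by rewrite (disjointFl AU aU).
Qed.

Lemma eq_reach e e' A U :
  (forall y z, y \in A :|: U -> z \in U -> e y z = e' y z) ->
  reach e A U = reach e' A U.
Proof.
move=> ee'; apply/eqP; rewrite eqEsubset.
have H e1 e2 : (forall y z, y \in A :|: U -> z \in U -> e1 y z = e2 y z) ->
    reach e1 A U \subset reach e2 A U.
  move=> e12.
  suff /subset_trans : reach e1 A U \subset (A :|: U) :&: reach e2 A U.
    by apply; exact: subsetIr.
  apply: reach_min => [|y z]; first by rewrite subsetI subsetUl sub_reach.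
  rewrite !(in_setI, in_setU) => /andP[yAU yR] yz zU.
  rewrite zU orbT /=; apply: reach_step yR _ (zU).
  by rewrite -e12 ?in_setU.
by rewrite !H // => y z yU zU; rewrite ee'.
Qed.

(** An exploration that ends with [C] never leaves [C], so it reads only the edges out of [C]. This
    is what makes the event independent of the rest of the graph. *)
Lemma reach_eq_local e e' A U C :
  (forall y z, y \in C -> z \in U -> e y z = e' y z) ->
  (reach e A U == C) = (reach e' A U == C).
Proof.
suff H e1 e2 : (forall y z, y \in C -> z \in U -> e1 y z = e2 y z) ->
    reach e1 A U == C -> reach e2 A U == C.
  move=> ee'; apply/idP/idP; apply: H => // y z yC zU.
  by rewrite ee'.
move=> e12 /eqP RC.
have sub2 : reach e2 A U \subset C.
  apply: reach_min => [|y z yC yz zU]; first by rewrite -RC sub_reach.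
  by rewrite -RC; apply: (reach_step (y := y)); rewrite ?RC // e12.
rewrite eqEsubset sub2 -RC; apply: reach_min => [|y z yR yz zU].
  exact: sub_reach.
apply: reach_step (yR) _ (zU); rewrite -e12 //.
exact: (subsetP sub2).
Qed.

(** Forbidding a return to [v] loses nothing: a path can be cut after its last visit of [v]. *)
Lemma reach_connect e v :
  reach e [set v] ([set: V] :\ v) = [set x | connect e v x].
Proof.
apply/eqP; rewrite eqEsubset; apply/andP; split.
  apply: reach_min => [|y z]; first by rewrite sub1set inE.
  by rewrite !inE => vy yz _; exact: connect_trans vy (connect1 yz).
apply/subsetP => x; rewrite inE => /connectP[p].
elim/last_ind: p x => [|p z IHp] x /=.
  by move=> _ ->; apply/(subsetP (sub_reach _ _ _)); rewrite inE.
rewrite rcons_path last_rcons => /andP[pp pz] ->.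
have [->|zv] := eqVneq z v.
  by apply/(subsetP (sub_reach _ _ _)); rewrite inE.
by apply: reach_step (IHp _ pp erefl) pz _; rewrite !inE zv.
Qed.

End Reach.

(** * Random edges and one step of the exploration *)

Section RandomGraph.
Variables (R : realFieldType) (N : nat).
Local Notation V := 'I_N.
Implicit Types (f g : {ffun V * V -> bool}) (A U B X : {set V}).

(* Edges are encoded by the pairs (i, j) with i < j; the bits f (i, j) with
   j <= i are ignored. *)
Definition edge (i j : V) : V * V := if (i < j)%N then (i, j) else (j, i).

Definition ad f : rel V := fun i j => (i != j) && f (edge i j).

Lemma edgeC i j : edge i j = edge j i.
Proof. by rewrite /edge; case: ltngtP => // /val_inj ->. Qed.

Lemma adC f i j : ad f i j = ad f j i.
Proof. by rewrite /ad eq_sym edgeC. Qed.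

Definition inside (X : {set V}) : {set V * V} :=
  [set p | (p.1 \in X) && (p.2 \in X)].

Lemma edge_inside X i j : (edge i j \in inside X) = (i \in X) && (j \in X).
Proof. by rewrite /edge; case: ifP => _; rewrite inE //= andbC. Qed.

Lemma depends_reach_inside A U X (T : Type) (F : {set V} -> T) :
  A :|: U \subset X -> depends_on (inside X) (fun f => F (reach (ad f) A U)).
Proof.
move=> AUX f g fg; congr F; apply: eq_reach => y z yAU zU; rewrite /ad fg //.
rewrite edge_inside (subsetP AUX) // (subsetP AUX) //.
by rewrite inE zU orbT.
Qed.

(** For [a] outside [U], the probability that [B] is the set of neighbours of [a] in [U]. *)
Definition nbr_prob (q : V * V -> R) (a : V) U B : R :=
  \prod_(x in U) bern (q (edge a x)) (x \in B).

Lemma bprob_nbr (q : V * V -> R) a U B : a \notin U -> B \subset U ->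
  bprob q (fun f => [set x in U | ad f a x] == B) = nbr_prob q a U B.
Proof.
move=> aU BU; rewrite /bprob /bexp.
(* The event constrains each bit separately: the bit of [edge a x] is forced, all others are free
   and sum to 1. *)
pose allowed (p : V * V) b :=
  [forall x in U, (p == edge a x) ==> (b == (x \in B))].
have edge_inj x y : edge a x = edge a y -> x = y.
  by rewrite /edge; case: ifP => _; case: ifP => _ [] // -> ->.
transitivity (\sum_(f : {ffun V * V -> bool} |
    f \in family (fun p => [pred b | allowed p b])) bweight q f).
  rewrite [RHS]big_mkcond; apply: eq_bigr => f _.
  have -> : (f \in family (fun p => [pred b | allowed p b])) =
            ([set x in U | ad f a x] == B).
    apply/familyP/eqP => [fP|BE p].
      apply/setP => x; rewrite inE; case: (boolP (x \in U)) => [xU|xU] /=.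
        have := fP (edge a x); rewrite inE => /forall_inP/(_ x xU).
        rewrite eqxx /= /ad => /eqP ->; case: (eqVneq a x) => // ax.
        by move: aU; rewrite ax xU.
      by apply/esym/negbTE; apply: contra xU; exact: (subsetP BU).
    rewrite inE; apply/forall_inP => x xU; apply/implyP => /eqP ->.
    rewrite -BE inE xU /ad /=; case: (eqVneq a x) => // ax.
    by move: aU; rewrite ax xU.
  by case: ifP => _; rewrite ?mulr1 ?mulr0.
rewrite -(bigA_distr_big_dep (fun p b => allowed p b)
           (fun p b => bern (q p) b)) /=.
rewrite (bigID (fun p => p \in [set edge a x | x in U])) /=.
rewrite [X in _ * X]big1 ?mulr1 => [|p pU]; last first.
  rewrite (eq_bigl xpredT) ?sum_bern // => b.
  apply/forall_inP => x xU; apply/implyP => /eqP pE.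
  by case/negP: pU; rewrite pE imset_f.
rewrite big_imset /= => [|x y _ _]; last exact: edge_inj.
apply: eq_bigr => x xU.
rewrite (big_pred1 (x \in B)) // => b.
apply/forall_inP/eqP => [/(_ x xU)|-> y yU]; first by rewrite eqxx => /eqP.
by apply/implyP => /eqP/edge_inj ->.
Qed.

(** Conditioning on the neighbours [B] of [a] in [U]; the rest of the exploration is independent of
    them. *)
Lemma bexp_explore (q : V * V -> R) A U a (F : nat -> R) :
  a \in A -> [disjoint A & U] ->
  bexp q (fun f => F #|reach (ad f) A U|) =
  \sum_(B : {set V} | B \subset U) nbr_prob q a U B *
    bexp q (fun f => F #|reach (ad f) ((A :\ a) :|: B) (U :\: B)|.+1).
Proof.
move=> aA AU; have aU : a \notin U by rewrite (disjointFr AU aA).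
transitivity (bexp q (fun f => \sum_(B : {set V} | B \subset U)
   ([set x in U | ad f a x] == B)%:R *
   F #|reach (ad f) ((A :\ a) :|: B) (U :\: B)|.+1)).
  apply: eq_bexp => f; rewrite (bigD1 [set x in U | ad f a x]) /=; last first.
    by apply/subsetP => x; rewrite inE => /andP[].
  rewrite eqxx mul1r (card_reach_explore _ aA AU) big1 ?addr0 // => B.
  by case/andP => _ /negbTE; rewrite eq_sym => ->; rewrite mul0r.
rewrite bexp_sum; apply: eq_bigr => B BU.
(* The neighbourhood event reads only pairs containing [a], the remaining exploration only pairs
   avoiding [a]. *)
rewrite -(bprob_nbr q aU BU); apply: (bexp_indep (J := ~: inside (~: [set a]))).
  move=> f g fg; congr (_ == _)%:R; apply/setP => x; rewrite !inE /ad fg //.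
  by rewrite inE edge_inside !inE eqxx.
rewrite setCK; apply: (@depends_reach_inside _ _ _ _ (fun X : {set V} => F #|X|.+1)).
apply/subsetP => x; rewrite !inE => xAU.
have xAU' : (x != a) && (x \in A) || (x \in U).
  move: xAU; case/orP => [/orP[->//|/(subsetP BU) ->]|/andP[_ ->]];
  by rewrite ?orbT.
by case/orP: xAU' => [/andP[]//|]; apply: contraL => /eqP ->.
Qed.

End RandomGraph.

(** * Upper and lower bounds for the size of the explored set *)

Section ExplorationBounds.
Variables (R : realFieldType) (N : nat).
Local Notation V := 'I_N.
Implicit Types (f g : {ffun V * V -> bool}) (A U B X : {set V}).
Implicit Types (q : V * V -> R).

Lemma prodrD_subset (I : finType) (U : {set I}) (F G : I -> R) :
  \prod_(i in U) (F i + G i) =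
  \sum_(B : {set I} | B \subset U) \prod_(i in U) (if i \in B then F i else G i).
Proof.
transitivity (\prod_i ((if i \in U then F i else 0) +
                       (if i \in U then G i else 1))).
  rewrite big_mkcond; apply: eq_bigr => i _.
  by case: ifP => _; rewrite ?add0r.
rewrite bigA_distr [RHS]big_mkcond /=; apply: eq_bigr => B _.
case: ifP => BU.
  rewrite [RHS]big_mkcond; apply: eq_bigr => i _.
  have [iB|iB] := boolP (i \in B); first by rewrite (subsetP BU).
  by case: ifP.
have /subsetPn[i iB iU] := negbT BU.
by rewrite (bigD1 i) //= iB (negbTE iU) mul0r.
Qed.

(** The generating function of the random neighbour set factors over the vertices of [U]. *)
Lemma sum_nbr_prob q a U (g : V -> R) :
  \sum_(B : {set V} | B \subset U) nbr_prob q a U B * \prod_(x in B) g x =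
  \prod_(x in U) (1 + q (edge a x) * (g x - 1)).
Proof.
transitivity (\prod_(x in U) (q (edge a x) * g x + (1 - q (edge a x)))).
  rewrite prodrD_subset; apply: eq_bigr => B BU.
  have -> : \prod_(x in B) g x = \prod_(x in U) (if x \in B then g x else 1).
    rewrite -big_mkcondr /=; apply: eq_bigl => x.
    by case: (boolP (x \in B)) => [/(subsetP BU) ->|]; rewrite ?andbF.
  rewrite -big_split; apply: eq_bigr => x _ /=; rewrite /bern.
  by case: ifP; rewrite ?mulr1.
by apply: eq_bigr => x _; ring.
Qed.

Lemma nbr_prob_ge0 q a U B : is_prob q -> 0 <= nbr_prob q a U B.
Proof. by move=> qP; apply: prodr_ge0 => x _; apply: bern_ge0. Qed.

Lemma reach0 (e : rel V) U : reach e set0 U = set0.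
Proof.
by apply/setP => x; rewrite in_set0; apply/negbTE/negP => /reachP[a]; rewrite inE.
Qed.

(* Exploring one vertex a of A replaces the bound \prod_(A) y by
   z * \prod_(A :\ a) y * \prod_x (1 + q(a,x) * (y x - 1)). *)
Lemma bexp_reach_le q (y : V -> R) (z : R) A U :
  is_prob q -> 0 <= z -> (forall x, 1 <= y x) ->
  (forall a, z * \prod_x (1 + q (edge a x) * (y x - 1)) <= y a) ->
  [disjoint A & U] ->
  bexp q (fun f => z ^+ #|reach (ad f) A U|) <= \prod_(x in A) y x.
Proof.
move=> qP z0 y1 yz.
have y0 x : 0 <= y x by apply: le_trans (y1 x).
(* Each step explores one vertex, which lowers the number of active and unexplored vertices by
   one. *)
have [n] := ubnP (#|A| + #|U|)%N; elim: n A U => // n IHn A U.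
have [->|[a aA]] := set_0Vmem A.
  move=> _ _; rewrite big_set0 -(bexp_cst q 1); apply/ler_eq/eq_bexp => f.
  by rewrite reach0 cards0.
rewrite ltnS => szAU AU; have aU : a \notin U by rewrite (disjointFr AU aA).
rewrite (bexp_explore q (fun k => z ^+ k) aA AU).
have IH B : B \subset U ->
    bexp q (fun f => z ^+ #|reach (ad f) (A :\ a :|: B) (U :\: B)|.+1) <=
    z * (\prod_(x in A :\ a) y x * \prod_(x in B) y x).
  move=> BU; under eq_bexp do rewrite exprS.
  rewrite bexpZ; apply: ler_wpM2l => //.
  have AB : [disjoint A :\ a & B].
    rewrite (disjointWr BU) // (disjointWl _ AU) //; exact: subsetDl.
  apply: le_trans (IHn _ _ _ _) _; last first.
  - rewrite -bigU //; apply/ler_eq/eq_bigl => x.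
    by rewrite in_setU.
  - rewrite disjoints_subset; apply/subsetP => x; rewrite !inE negb_and negbK.
    case: (boolP (x \in B)) => //= _; rewrite orbF => /andP[_ xA].
    by rewrite (disjointFr AU xA).
  have := cardsD1 a A; rewrite aA => cA; have := subset_leq_card BU.
  have := cardsD U B; rewrite (setIidPr BU) => cUB.
  have := cardsU (A :\ a) B; rewrite (disjoint_setI0 AB) cards0 subn0.
  lia.
apply: (@le_trans _ _ (\sum_(B : {set V} | B \subset U)
    (nbr_prob q a U B * \prod_(x in B) y x) * (z * \prod_(x in A :\ a) y x))).
  apply: ler_sum => B BU; rewrite -mulrA; apply: ler_wpM2l.
    exact: nbr_prob_ge0.
  by apply: le_trans (IH B BU) _; apply/ler_eq; ring.
rewrite -mulr_suml sum_nbr_prob (big_setD1 a aA) /= mulrA.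
apply: ler_wpM2r; first exact: prodr_ge0.
apply: le_trans (yz a); rewrite mulrC; apply: ler_wpM2l => //.
(* The factors of the vertices outside [U] are at least 1 since [y >= 1], so the product may be
   extended to all vertices. *)
rewrite [leRHS](bigID (fun x => x \in U)) /=.
have ge1 x : 1 <= 1 + q (edge a x) * (y x - 1).
  by rewrite lerDl mulr_ge0 ?subr_ge0 //; case/andP: (qP (edge a x)).
rewrite ler_peMr //; first by apply: prodr_ge0 => x _; exact: le_trans (ge1 x).
by elim/big_rec: _ => // x s _ s1; exact: mulr_ege1.
Qed.

Lemma nbr_prob_cst q (p : R) a U B : B \subset U ->
  (forall x, x \in U -> q (edge a x) = p) ->
  nbr_prob q a U B = p ^+ #|B| * (1 - p) ^+ (#|U| - #|B|).
Proof.
move=> BU qp; rewrite /nbr_prob.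
rewrite (big_setID B) /= (setIidPr BU); congr (_ * _).
  rewrite (eq_bigr (fun=> p)) ?prodr_const // => x xB.
  by rewrite xB qp // (subsetP BU).
rewrite (eq_bigr (fun=> 1 - p)) ?prodr_const ?cardsD ?(setIidPr BU) // => x.
by rewrite inE => /andP[/negbTE -> xU]; rewrite qp.
Qed.

Lemma sum_subset_card (I : finType) (U : {set I}) (F : nat -> R) :
  \sum_(B : {set I} | B \subset U) F #|B| =
  \sum_(b < #|U|.+1) 'C(#|U|, b)%:R * F b.
Proof.
rewrite (partition_big (fun B : {set I} => inord #|B| : 'I_#|U|.+1) xpredT) //=.
apply: eq_bigr => b _.
rewrite (eq_bigl (fun B : {set I} => (B \subset U) && (#|B| == b))); last first.
  move=> B; case: (boolP (B \subset U)) => //= /subset_leq_card cB.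
  by rewrite -val_eqE /= inordK.
rewrite (eq_bigr (fun=> F b)) => [|B /andP[_ /eqP ->] //].
rewrite sumr_const -cards_draws mulr_natl; congr (_ *+ _).
by apply: eq_card => B; rewrite !inE.
Qed.

(** The derivative of the binomial formula, from [b 'C(m, b) = m 'C(m - 1, b - 1)]. *)
Lemma sum_bin_mulr_nat (K : R) m :
  \sum_(b < m.+1) 'C(m, b)%:R * b%:R * K ^+ (m - b) = m%:R * (K + 1) ^+ m.-1.
Proof.
case: m => [|m]; first by rewrite big_ord_recl big_ord0 /= !mul0r mulr0 mul0r addr0.
rewrite big_ord_recl /= mulr0 mul0r add0r exprDn mulr_sumr.
apply: eq_bigr => i _; rewrite expr1n mulr1 -[K ^+ _ *+ _]mulr_natl mulrA.
by rewrite -!natrM mul_bin_diag /bump add1n subSS [(_ * i.+1)%N]mulnC.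
Qed.

(** Both sides count pairs of nested subsets of sizes [b] and [m] of a set of size [u]. *)
Lemma mul_bin_sub u m b : (b <= m)%N -> (m <= u)%N ->
  ('C(u, b) * 'C(u - b, m - b) = 'C(u, m) * 'C(m, b))%N.
Proof.
move=> bm mu; have bu := leq_trans bm mu.
have f0 : (0 < b`! * ((m - b)`! * (u - m)`!))%N by rewrite !muln_gt0 !fact_gt0.
apply/eqP; rewrite -(eqn_pmul2r f0); apply/eqP.
have E : (u - b - (m - b) = u - m)%N by lia.
have := bin_fact bu; have := bin_fact mu; have := bin_fact bm.
have := @bin_fact (u - b) (m - b) (leq_sub2r _ mu); rewrite E.
set x := 'C(u, b); set y := 'C(_, _); set z := 'C(u, m); set w := 'C(m, b).
move=> <- E1 E2 E3.
transitivity u`!; [rewrite -E3|rewrite -E2 -E1]; lia.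
Qed.

(* By Cayley's formula, C(u, k-a) * (a/k) * k^(k-a) is the number of forests on
   k vertices of A :|: U with root set A. *)
Lemma bprob_card_reach_ge q (p : R) (k : nat) A U :
  is_prob q -> 0 <= p <= 1 -> (0 < k)%N -> (#|A| <= k)%N -> [disjoint A & U] ->
  (forall y x, y \in A :|: U -> x \in U -> y != x -> q (edge y x) = p) ->
  'C(#|U|, k - #|A|)%:R * (#|A|%:R / k%:R) * k%:R ^+ (k - #|A|) *
     p ^+ (k - #|A|) * (1 - p) ^+ (k * #|U|)
  <= bprob q (fun f => #|reach (ad f) A U| == k).
Proof.
move=> qP /andP[p0 p1]; have p1' : 0 <= 1 - p by rewrite subr_ge0.
have p1'' : 1 - p <= 1 by rewrite lerBlDr lerDl.
case: k => // k _; elim: k A U => [|K IH] A U Ak AU qp.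
  have [A0|[a aA]] := set_0Vmem A.
    by rewrite A0 cards0 mul0r mulr0 !mul0r bprob_ge0.
  have A1 : A = [set a].
    by apply/eqP; rewrite eq_sym eqEcard sub1set aA cards1.
  rewrite /bprob (bexp_explore q (fun k => (k == 1%N)%:R) aA AU).
  rewrite (bigD1 set0) ?sub0set //= (nbr_prob_cst (p := p)) ?sub0set //; last first.
    move=> x xU; apply: qp => //; first by rewrite inE aA.
    by apply: contraTneq xU => <-; rewrite (disjointFr AU aA).
  rewrite A1 cards1 setDv set0U setD0 cards0 !expr0 subn0 mul1n subnn bin0.
  rewrite divr1 !mulr1 !mul1r.
  under eq_bexp do rewrite reach0 cards0.
  rewrite bexp_cst mulr1 lerDl; apply: sumr_ge0 => B _.
  by rewrite mulr_ge0 ?nbr_prob_ge0 ?bexp_ge0.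
have [A0|[a aA]] := set_0Vmem A.
  by rewrite A0 cards0 mul0r mulr0 !mul0r bprob_ge0.
set m := (K.+2 - #|A|)%N.
rewrite /bprob (bexp_explore q (fun k => (k == K.+2)%:R) aA AU).
have cA : #|A :\ a| = #|A|.-1 by rewrite (cardsD1 a A) aA.
have A0 : (0 < #|A|)%N by rewrite (cardsD1 a A) aA.
(* The induction bound when [a] has [b] neighbours, of which at most [m] are allowed: [m] vertices
   are missing for the target size. *)
pose c b : R := (if (b <= m)%N then 'C(#|U| - b, m - b)%:R *
   ((#|A|.-1 + b)%:R / K.+1%:R) * K.+1%:R ^+ (m - b) else 0)
   * p ^+ m * (1 - p) ^+ (K.+2 * #|U|).
apply: (@le_trans _ _ (\sum_(B : {set V} | B \subset U) c #|B|)); last first.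
  apply: ler_sum => B BU.
  rewrite (nbr_prob_cst (p := p)) //; last first.
    move=> x xU; apply: qp => //; first by rewrite inE aA.
    by apply: contraTneq xU => <-; rewrite (disjointFr AU aA).
  rewrite /c; case: ifP => Bm; last first.
    by rewrite !mul0r !mulr_ge0 ?exprn_ge0 ?bexp_ge0.
  have cAB : #|A :\ a :|: B| = (#|A|.-1 + #|B|)%N.
    rewrite cardsU cA (_ : _ :&: _ = set0) ?cards0 ?subn0 //.
    apply: disjoint_setI0.
    rewrite (disjointWr BU) // (disjointWl _ AU) //; exact: subsetDl.
  have cUB : #|U :\: B| = (#|U| - #|B|)%N by rewrite cardsD (setIidPr BU).
  have ABm : (K.+1 - (#|A|.-1 + #|B|) = m - #|B|)%N by rewrite /m; lia.
  have BUc := subset_leq_card BU.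
  have := IH (A :\ a :|: B) (U :\: B); rewrite cAB cUB ABm.
  move=> /(_ _ _ _)IH1.
  apply: le_trans (ler_wpM2l _ (IH1 _ _ _)); last 4 first.
  - by rewrite mulr_ge0 ?exprn_ge0.
  - by rewrite /m in Bm; lia.
  - rewrite disjoints_subset; apply/subsetP => x; rewrite !inE negb_and negbK.
    case: (boolP (x \in B)) => //= _; rewrite orbF => /andP[_ xA].
    by rewrite (disjointFr AU xA).
  - move=> y x yAU; rewrite inE => /andP[_ xU]; apply: qp => //.
    move: yAU; rewrite !inE.
    case/orP => [/orP[/andP[_ ->] //|/(subsetP BU) ->]|/andP[_ ->]];
      by rewrite ?orbT.
  have -> : p ^+ m = p ^+ #|B| * p ^+ (m - #|B|) by rewrite -exprD subnKC.
  set D := _ * (_ / _) * _.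
  have D0 : 0 <= D by rewrite !mulr_ge0 ?exprn_ge0 ?divr_ge0.
  rewrite [leRHS](_ : _ = D * (p ^+ #|B| * p ^+ (m - #|B|)) *
     (1 - p) ^+ (#|U| - #|B| + K.+1 * (#|U| - #|B|))); last first.
    by rewrite exprD; ring.
  apply: ler_wpM2l; first by rewrite !mulr_ge0 ?exprn_ge0.
  (* The present step costs at most [#|U|] factors [1 - p], the later ones at most [K.+1 * #|U|]. *)
  by apply: ler_wiXn2l => //; rewrite -mulSn leq_mul // leq_subr.
rewrite sum_subset_card /c.
rewrite (eq_bigr (fun i : 'I_#|U|.+1 => ('C(#|U|, i)%:R * (if (i <= m)%N then
    'C(#|U| - i, m - i)%:R * ((#|A|.-1 + i)%:R / K.+1%:R) * K.+1%:R ^+ (m - i)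
    else 0)) * p ^+ m * (1 - p) ^+ (K.+2 * #|U|))); last by move=> i _; rewrite !mulrA.
rewrite -!mulr_suml.
apply: ler_wpM2r; first exact: exprn_ge0.
apply: ler_wpM2r; first exact: exprn_ge0.
have [Um|mU] := ltnP #|U| m.
  rewrite bin_small // !mul0r; apply: sumr_ge0 => b _.
  by case: ifP => _; rewrite ?mulr0 ?mulr_ge0 ?exprn_ge0 ?divr_ge0.
pose F b : R := 'C(#|U|, m)%:R * ('C(m, b)%:R *
    ((#|A|.-1 + b)%:R / K.+1%:R) * K.+1%:R ^+ (m - b)).
have -> : \sum_(i < #|U|.+1) 'C(#|U|, i)%:R * (if (i <= m)%N then
    'C(#|U| - i, m - i)%:R * ((#|A|.-1 + i)%:R / K.+1%:R) * K.+1%:R ^+ (m - i)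
    else 0) = \sum_(i < m.+1) F i.
  rewrite (big_ord_widen #|U|.+1 F) ?ltnS // [RHS]big_mkcond.
  apply: eq_bigr => i _ /=; rewrite ltnS; case: leqP => // im; rewrite ?mulr0 //.
  by rewrite /F !mulrA -!natrM mul_bin_sub.
rewrite /F -mulr_sumr -[leLHS]mulrA; apply: ler_wpM2l => //.
(* Splitting [(#|A| - 1) + i] gives the binomial formula and its derivative; with [m = K + 2 - #|A|]
   their sum collapses to [#|A| (K + 2)^(m - 1)]. *)
have -> : \sum_(i < m.+1) 'C(m, i)%:R * ((#|A|.-1 + i)%:R / K.+1%:R) *
    K.+1%:R ^+ (m - i) = (#|A|.-1%:R * \sum_(i < m.+1) 'C(m, i)%:R *
    K.+1%:R ^+ (m - i) + \sum_(i < m.+1) 'C(m, i)%:R * i%:R *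
    K.+1%:R ^+ (m - i)) / K.+1%:R :> R.
  rewrite mulr_sumr -big_split mulr_suml; apply: eq_bigr => i _ /=.
  by rewrite natrD; ring.
have -> : \sum_(i < m.+1) 'C(m, i)%:R * K.+1%:R ^+ (m - i) = K.+2%:R ^+ m :> R.
  rewrite -[K.+2]addn1 natrD exprDn; apply: eq_bigr => i _.
  by rewrite expr1n mulr1 mulr_natl.
rewrite sum_bin_mulr_nat -natr1 natr1.
have K0 : (K.+1)%:R != 0 :> R by rewrite pnatr_eq0.
have K20 : (K.+2)%:R != 0 :> R by rewrite pnatr_eq0.
have mA : m%:R = K.+2%:R - #|A|%:R :> R by rewrite /m natrB.
have A1 : #|A|.-1%:R = #|A|%:R - 1 :> R by rewrite -[in RHS](prednK A0) -natr1 addrK.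
have K21 : K.+2%:R = K.+1%:R + 1 :> R by rewrite -natr1.
case: (posnP m) => [m0|m_gt0].
  move: mA; rewrite m0 mulr0n => /eqP; rewrite eq_sym subr_eq0 => /eqP AK.
  by rewrite !expr0 /= mul0r addr0 !mulr1 A1 -AK K21 addrK -K21 !divff.
rewrite -(prednK m_gt0) exprS /= prednK // mA A1.
apply: ler_eq; move: K0 K20; rewrite K21.
by move: (K.+1%:R : R) => x x0 x1; field; rewrite x0 x1.
Qed.
End ExplorationBounds.

(** * Components of the planted graph *)

Section Components.
Variables (R : realFieldType) (N : nat).
Local Notation V := 'I_N.
Implicit Types (f g : {ffun V * V -> bool}) (A U B C S : {set V}).
Implicit Types (q : V * V -> R).

Definition component_in f U (v : V) : {set V} := reach (ad f) [set v] (U :\ v).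

Definition all_small (k : nat) f U : bool := [forall v in U, #|component_in f U v| < k]%N.

Lemma component_in_mono f U U' v : U \subset U' ->
  component_in f U v \subset component_in f U' v.
Proof. by move=> UU'; apply: reach_mono => //; exact: setSD. Qed.

Lemma all_small_sub k f U U' : U' \subset U -> all_small k f U -> all_small k f U'.
Proof.
move=> UU' /forall_inP sU; apply/forall_inP => v vU'.
apply: leq_ltn_trans (sU v (subsetP UU' v vU')).
exact/subset_leq_card/component_in_mono.
Qed.

Lemma depends_component_in U v (T : Type) (F : {set V} -> T) : v \in U ->
  depends_on (inside U) (fun f => F (component_in f U v)).
Proof.
move=> vU; apply: depends_reach_inside.
by rewrite subUset sub1set vU subsetDl.
Qed.

Lemma depends_all_small k U : depends_on (inside U) (fun f => all_small k f U).
Proof.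
move=> f g fg; apply: eq_forallb_in => v vU.
by rewrite (depends_component_in (fun C : {set V} => (#|C| < k)%N) vU fg).
Qed.

(** The event that [v] has component [C] reads only pairs meeting [C], so it is independent of the
    graph on [U :\: C], whose components are still small. *)
Lemma all_small_explore k q U v : is_prob q -> v \in U ->
  bprob q (fun f => all_small k f U) <=
  \sum_(C : {set V} | (#|C| < k)%N)
     bprob q (fun f => component_in f U v == C) *
     bprob q (fun f => all_small k f (U :\: C)).
Proof.
move=> qP vU.
apply: (@le_trans _ _ (bexp q (fun f => \sum_(C : {set V} | (#|C| < k)%N)
   (component_in f U v == C)%:R * (all_small k f (U :\: C))%:R))).
  apply: ler_bexp => // f; case: (boolP (all_small k f U)) => [sU|_]; last first.
    by apply: sumr_ge0 => C _; rewrite mulr_ge0.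
  rewrite (bigD1 (component_in f U v)) /=; last by move/forall_inP: sU; apply.
  rewrite eqxx (all_small_sub (subsetDl _ _) sU) mulr1 lerDl.
  by apply: sumr_ge0 => C _; rewrite mulr_ge0.
rewrite bexp_sum; apply/ler_eq/eq_bigr => C _.
apply: (bexp_indep (J := ~: inside (~: C))).
  move=> f g fg; congr (_%:R); congr (nat_of_bool _).
  apply: reach_eq_local => y z yC _; rewrite /ad fg //.
  by rewrite inE edge_inside !inE yC.
rewrite setCK => f g fg; congr (nat_of_bool _)%:R.
apply: depends_all_small => p; rewrite inE => /andP[p1 p2]; apply: fg.
by move: p1 p2; rewrite !inE => /andP[-> _] /andP[-> _].
Qed.

(** These are [M] successive trials: a failed trial removes fewer than [k] vertices, and whatever
    was removed some remaining vertex fails with probability at most [r]. *)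
Lemma bprob_all_small_le k q (r : R) M U : is_prob q -> 0 <= r ->
  (forall U', U' \subset U -> (#|U :\: U'| <= M * k)%N -> exists2 v, v \in U' &
     bprob q (fun f => #|component_in f U' v| < k)%N <= r) ->
  bprob q (fun f => all_small k f U) <= r ^+ M.
Proof.
move=> qP r0; elim: M U => [|M IH] U Ur; first by rewrite expr0 bprob_le1.
have [|v vU vr] := Ur U (subxx _); first by rewrite setDv cards0.
apply: le_trans (all_small_explore k qP vU) _.
apply: (@le_trans _ _ (\sum_(C : {set V} | (#|C| < k)%N)
    bprob q (fun f => component_in f U v == C) * r ^+ M)).
  apply: ler_sum => C Ck; apply: ler_wpM2l; first exact: bprob_ge0.
  apply: IH => U' U'U cU'; apply: Ur.
    by apply: subset_trans U'U (subsetDl _ _).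
  have : U :\: U' \subset (U :\: C :\: U') :|: C.
    by apply/subsetP => x; rewrite !inE => /andP[-> ->]; case: (x \in C).
  move/subset_leq_card/leq_trans; apply; apply: leq_trans (leq_card_setU _ _) _.
  by rewrite mulSn addnC leq_add // ltnW.
rewrite -mulr_suml exprS; apply: ler_wpM2r; first exact: exprn_ge0.
apply: le_trans vr; rewrite -bexp_sum; apply: ler_bexp => // f.
case: (boolP (_ < _)%N) => [Ck|Ck].
  rewrite (bigD1 (component_in f U v)) //= eqxx big1 ?addr0 // => C /andP[_].
  by rewrite eq_sym => /negbTE ->.
rewrite big1 // => C Ck'; case: eqP => // CE.
by move: Ck; rewrite CE Ck'.
Qed.

(** Markov's inequality for [z ^+ #|C(v)|]. *)
Lemma bprob_component_ge q (y : V -> R) (z : R) k U v : is_prob q -> 1 <= z ->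
  (forall x, 1 <= y x) ->
  (forall a, z * \prod_x (1 + q (edge a x) * (y x - 1)) <= y a) ->
  bprob q (fun f => k <= #|component_in f U v|)%N <= y v / z ^+ k.
Proof.
move=> qP z1 y1 yz; have z0 : 0 < z by apply: lt_le_trans z1.
rewrite ler_pdivlMr ?exprn_gt0 // mulrC -bexpZ.
have dis : [disjoint [set v] & U :\ v].
  by rewrite disjoints_subset sub1set !inE eqxx.
have := bexp_reach_le qP (ltW z0) y1 yz dis.
rewrite big_set1; apply: le_trans.
apply: ler_bexp => // f; case: (boolP (_ <= _)%N) => [kc|_].
  by rewrite mulr1 ler_weXn2l.
by rewrite mulr0 exprn_ge0 // ltW.
Qed.

Definition planted (p0 p1 : R) S (e : V * V) : R :=
  if (e.1 \in S) && (e.2 \in S) then p1 else p0.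

Lemma planted_edge p0 p1 S i j :
  planted p0 p1 S (edge i j) = if (i \in S) && (j \in S) then p1 else p0.
Proof. by rewrite /planted /edge; case: (i < j)%N => //=; rewrite andbC. Qed.

Lemma planted_prob p0 p1 S : 0 <= p0 <= 1 -> 0 <= p1 <= 1 ->
  is_prob (planted p0 p1 S).
Proof. by move=> p0P p1P e; rewrite /planted; case: ifP. Qed.

(* The bound of bprob_card_reach_ge, with distinct sizes u and u' in the
   binomial coefficient and in the exponent: it is monotone in each of them. *)
Definition cluster_bound (p : R) (a m u u' : nat) : R :=
  'C(u, m - a)%:R * (a%:R / m%:R) * m%:R ^+ (m - a) * p ^+ (m - a) *
  (1 - p) ^+ (m * u').

Lemma cluster_bound_ge0 p a m u u' : 0 <= p <= 1 -> 0 <= cluster_bound p a m u u'.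
Proof.
case/andP => p0 p1; rewrite /cluster_bound.
by rewrite !mulr_ge0 ?exprn_ge0 ?invr_ge0 ?subr_ge0.
Qed.

Lemma cluster_bound_le p a m u u' w w' : 0 <= p <= 1 -> (u <= w)%N -> (w' <= u')%N ->
  cluster_bound p a m u u' <= cluster_bound p a m w w'.
Proof.
case/andP => p0 p1 uw wu; have p1' : 0 <= 1 - p by rewrite subr_ge0.
rewrite /cluster_bound; apply: ler_pM; rewrite ?mulr_ge0 ?exprn_ge0 ?invr_ge0 //.
  rewrite !ler_wpM2r ?exprn_ge0 ?mulr_ge0 ?invr_ge0 // ler_nat.
  exact: leq_bin2l.
by apply: ler_wiXn2l; rewrite ?lerBlDr ?lerDl // leq_mul.
Qed.

(* First grow a cluster of m vertices inside S, then a forest outside S rooted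
   at it. *)
Lemma bprob_planted_component_ge p0 p1 S U v m k : 0 <= p0 <= 1 -> 0 <= p1 <= 1 ->
  (0 < m <= k)%N -> v \in U :&: S ->
  cluster_bound p1 1 m #|U :&: S|.-1 #|U :&: S|.-1 *
  cluster_bound p0 m k #|U :\: S| #|U :\: S| <=
  bprob (planted p0 p1 S) (fun f => k <= #|component_in f U v|)%N.
Proof.
move=> p0P p1P /andP[m0 mk] vUS; have qP := planted_prob S p0P p1P.
set q := planted p0 p1 S; set US := U :&: S.
have vS : v \in S by move: vUS; rewrite inE => /andP[].
have cUS : #|US :\ v| = #|US|.-1 by rewrite (cardsD1 v US) vUS.
have h1 : cluster_bound p1 1 m #|US|.-1 #|US|.-1 <=
          bprob q (fun f => #|component_in f US v| == m).
  have := @bprob_card_reach_ge _ _ q p1 m [set v] (US :\ v) qP p1P m0.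
  rewrite cards1 cUS; apply => //.
    by rewrite disjoints_subset sub1set !inE eqxx.
  move=> y x yP xP _; rewrite /q planted_edge.
  have -> : x \in S by move: xP; rewrite !inE => /and3P[].
  suff -> : y \in S by [].
  by move: yP; rewrite !inE => /orP[/eqP ->|/and3P[]].
have h2 C : C \subset US -> #|C| = m ->
    cluster_bound p0 m k #|U :\: S| #|U :\: S| <=
    bprob q (fun f => #|reach (ad f) C (U :\: S)| == k).
  move=> CUS Cm.
  have := @bprob_card_reach_ge _ _ q p0 k C (U :\: S) qP p0P (leq_trans m0 mk).
  rewrite Cm; apply => //.
    rewrite disjoints_subset; apply/subsetP => x /(subsetP CUS).
    by rewrite !inE => /andP[_ ->].
  move=> y x _; rewrite inE => /andP[xS _] _.
  by rewrite /q planted_edge (negbTE xS) andbF.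
have cb0 := cluster_bound_ge0 m k #|U :\: S| #|U :\: S| p0P.
apply: le_trans (ler_wpM2r cb0 h1) _.
have -> : bprob q (fun f => #|component_in f US v| == m) =
    \sum_(C : {set V} | (C \subset US) && (#|C| == m))
      bprob q (fun f => component_in f US v == C).
  rewrite -bexp_sum; apply: eq_bexp => f.
  have sub : component_in f US v \subset US.
    apply: subset_trans (reach_subU _ _ _) _.
    by rewrite subUset sub1set vUS subsetDl.
  case: eqP => [cm|cm].
    rewrite (bigD1 (component_in f US v)) ?sub ?cm //= eqxx big1 ?addr0 // => C.
    by case/andP => _; rewrite eq_sym => /negbTE ->.
  rewrite big1 // => C /andP[_ /eqP Cm]; case: eqP => // E.
  by case: cm; rewrite E.
rewrite mulr_suml.
apply: (@le_trans _ _ (\sum_(C : {set V} | (C \subset US) && (#|C| == m))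
   bexp q (fun f => (component_in f US v == C)%:R *
                    (#|reach (ad f) C (U :\: S)| == k)%:R))).
  apply: ler_sum => C /andP[CUS /eqP Cm].
  (* The cluster reads only pairs inside [S]; every step of the forest lands outside [S] and so
     reads another pair. *)
  rewrite (bexp_indep (J := inside S)).
  - by apply: ler_wpM2l; [exact: bprob_ge0|exact: h2].
  - move=> f g fg; congr (nat_of_bool _)%:R.
    rewrite (depends_component_in (fun D => D == C) vUS (f := f) (g := g)) // => p.
    by rewrite !inE => /andP[/andP[_ p1S] /andP[_ p2S]]; apply: fg; rewrite !inE p1S.
  - move=> f g fg.
    suff -> : reach (ad f) C (U :\: S) = reach (ad g) C (U :\: S) by [].
    apply: eq_reach => y z _; rewrite inE => /andP[zS _].
    by rewrite /ad fg // inE edge_inside (negbTE zS) andbF.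
(* Only [C] equal to the cluster contributes, and what it reaches outside [S] lies in the component
   of [v] in [U]. *)
rewrite -bexp_sum; apply: ler_bexp => // f.
apply: (@le_trans _ _ (#|reach (ad f) (component_in f US v) (U :\: S)| == k)%:R).
  rewrite big_mkcond (bigD1 (component_in f US v)) //= eqxx mul1r big1 ?addr0 => [|C].
    by case: ifP => // _; rewrite ler0n.
  by rewrite eq_sym => /negbTE ->; rewrite mul0r; case: ifP.
rewrite ler_nat; case: eqP => // rk.
rewrite (_ : (k <= _)%N = true) // -rk; apply: subset_leq_card.
apply: subset_trans (reach_trans _ _ _ _) _; apply: reach_mono => //.
apply/subsetP => x; rewrite !inE; have [->|] := eqVneq x v; first by rewrite vS.
by move=> _ /=; case/orP => /andP[].
Qed.

(** After the removal of at most [M * k] vertices there remain [u] vertices in [S] and [w] outside,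
    so by monotonicity the same cluster bounds serve every trial. *)
Lemma planted_all_small p0 p1 S k m M u w (r : R) : 0 <= p0 <= 1 -> 0 <= p1 <= 1 ->
  (0 < m <= k)%N -> (0 < u)%N -> (u + M * k <= #|S|)%N ->
  (w <= N - #|S| - M * k)%N ->
  0 <= r ->
  1 - cluster_bound p1 1 m u.-1 #|S| * cluster_bound p0 m k w (N - #|S|) <= r ->
  bprob (planted p0 p1 S) (fun f => all_small k f [set: V]) <= r ^+ M.
Proof.
move=> p0P p1P mk u0 uS wS r0 rP; have qP := planted_prob S p0P p1P.
have main U : (#|[set: V] :\: U| <= M * k)%N -> exists2 v, v \in U &
    bprob (planted p0 p1 S) (fun f => #|component_in f U v| < k)%N <= r.
  move=> cU.
  have cUS : (u <= #|U :&: S|)%N.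
    have : (#|S :\: U| <= M * k)%N.
      by apply: leq_trans cU; apply/subset_leq_card/setSD/subsetT.
    rewrite cardsD setIC.
    have := subset_leq_card (subsetIr U S); lia.
  have [v vUS] : exists v, v \in U :&: S by apply/card_gt0P; lia.
  exists v; first by move: vUS; rewrite inE => /andP[].
  have -> : bprob (planted p0 p1 S) (fun f => #|component_in f U v| < k)%N =
      1 - bprob (planted p0 p1 S) (fun f => k <= #|component_in f U v|)%N.
    by rewrite -bprobC; apply: eq_bexp => f; rewrite ltnNge.
  apply: le_trans rP; rewrite lerB //.
  apply: le_trans (bprob_planted_component_ge p0P p1P mk vUS).
  apply: ler_pM; rewrite ?cluster_bound_ge0 //; apply: cluster_bound_le => //.
  - by lia.
  - by have := subset_leq_card (subsetIr U S); lia.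
  - have : (#|~: S| <= #|U :\: S| + M * k)%N.
      apply: leq_trans (leq_add (leqnn _) cU).
      rewrite -cardsUI; apply: leq_trans (leq_addr _ _).
      apply: subset_leq_card; apply/subsetP => x; rewrite !inE => ->.
      by case: (x \in U).
    have := cardsC S; rewrite card_ord; lia.
  - have := cardsC S; rewrite card_ord.
    suff : (#|U :\: S| <= #|~: S|)%N by lia.
    by rewrite setDE; apply/subset_leq_card/subsetIr.
by apply: bprob_all_small_le => // U' _; exact: main.
Qed.

(* Inside the complement of S, the planted and the null graphs have the same
   law. *)
Lemma null_all_small_le p0 p1 S k : 0 <= p0 <= 1 -> 0 <= p1 <= 1 ->
  bprob (planted p0 p0 S) (fun f => all_small k f [set: V]) <=
  bprob (planted p0 p1 S) (fun f => all_small k f [set: V]) +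
  \sum_(v in S) bprob (planted p0 p1 S) (fun f => k <= #|component_in f [set: V] v|)%N.
Proof.
move=> p0P p1P; have qP := planted_prob S p0P p1P.
apply: (@le_trans _ _ (bprob (planted p0 p0 S) (fun f => all_small k f (~: S)))).
  apply: le_bprob; first exact: planted_prob.
  by move=> f; apply: all_small_sub; exact: subsetT.
rewrite [leLHS](eq_bexp_on (J := inside (~: S)) (q' := planted p0 p1 S)); first last.
- by move=> f g fg; congr (nat_of_bool _)%:R; exact: depends_all_small.
- by move=> e; rewrite !inE /planted => /andP[/negbTE -> _].
have eU := bprob_exists (mem S)
  (fun v f => k <= #|component_in f [set: V] v|)%N qP.
apply: le_trans (lerD (lexx _) eU); apply: le_trans (bprobU _ _ qP).
apply: le_bprob => // f sC; rewrite -implyNb; apply/implyP.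
rewrite negb_forall => /existsP[v]; rewrite negb_imply -leqNgt => /andP[_ kv].
(* A large component meeting [S] is the component of a vertex of [S]; one avoiding [S] is also a
   component of the graph on [~: S]. *)
have [/exists_inP[s sS sv]|nS] := boolP [exists s in S, s \in component_in f [set: V] v].
  apply/exists_inP; exists s => //; apply: leq_trans kv _.
  move: sv; rewrite /component_in !reach_connect inE => vs; apply: subset_leq_card.
  apply/subsetP => x; rewrite !inE; apply: connect_trans.
  by rewrite (sym_connect_sym (adC f)).
have sub : component_in f [set: V] v \subset component_in f (~: S) v.
  have cS x : x \in component_in f [set: V] v -> x \notin S.
    by move=> xc; apply: contra nS => xS; apply/exists_inP; exists x.
  suff /subset_trans : component_in f [set: V] v \subset
       component_in f [set: V] v :&: component_in f (~: S) v.
    by apply; exact: subsetIr.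
  apply: reach_min => [|y z]; first by rewrite subsetI !sub_reach.
  rewrite !in_setI => /andP[y1 y2] yz zv.
  have z1 := reach_step y1 yz zv; rewrite z1; apply: reach_step y2 yz _.
  by move: zv; rewrite !inE (cS z z1) => /andP[->].
have vS : v \in ~: S.
  rewrite inE; apply: contra nS => vS; apply/exists_inP; exists v => //.
  by apply/(subsetP (sub_reach _ _ _)); rewrite inE.
move/forall_inP/(_ v vS): sC; rewrite ltnNge.
by rewrite (leq_trans kv) // subset_leq_card.
Qed.

End Components.

(** * From independent bits to the law of the adjacency matrix *)

Section GraphLaw.
Variables (R : realType) (N : nat).
Local Notation V := 'I_N.
Implicit Types (f : {ffun V * V -> bool}).

Lemma graph_of_subproof f : is_adjacency (\matrix_(i, j) ad f i j).
Proof.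
apply/andP; split; first by apply/forallP => i; rewrite mxE /ad eqxx.
by apply/forallP => i; apply/forallP => j; rewrite !mxE adC.
Qed.

Definition graph_of f : sgraph N :=
  exist (fun W : 'M[bool]_N => is_adjacency W) _ (graph_of_subproof f).

Lemma adj_graph_of f : adj (graph_of f) =2 ad f.
Proof. by move=> i j; rewrite /adj /= mxE. Qed.

(** The bits [f (i, j)] with [j <= i] do not affect [graph_of f] and sum to 1 over each fibre, which
    leaves the product over [i < j]. *)
Lemma graph_prE (q : V -> V -> R) (A : pred (sgraph N)) :
  graph_pr q A = bprob (fun e => q e.1 e.2) (fun f => A (graph_of f)).
Proof.
rewrite /bprob /bexp (partition_big graph_of xpredT) //= /graph_pr big_mkcond.
apply: eq_bigr => G _.
transitivity ((A G)%:R * \sum_(f | graph_of f == G)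
    bweight (fun e => q e.1 e.2) f); last first.
  by rewrite mulr_sumr; apply: eq_bigr => f /eqP ->; rewrite mulrC.
pose allowed (e : V * V) (b : bool) := (e.1 < e.2)%N ==> (b == adj G e.1 e.2).
have GP := valP G; move/andP: GP => [/forallP GP1 /forallP GP2].
rewrite (eq_bigl (fun f => f \in family (fun e => [pred b | allowed e b]))); last first.
  move=> f; apply/eqP/familyP => [fG e|fG].
    rewrite inE /allowed -fG adj_graph_of /ad /edge; apply/implyP => e12.
    by rewrite e12 -surjective_pairing neq_ltn e12.
  apply: val_inj; apply/matrixP => i j; rewrite /= mxE /ad.
  have [->|ij] := eqVneq i j; first by rewrite (negbTE (GP1 _)).
  have H (a b : V) : (a < b)%N -> f (a, b) = val G a b.
    by move=> ab; have := fG (a, b); rewrite inE /allowed /= ab => /eqP.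
  rewrite /edge; case: ltngtP => [|ji|/val_inj /eqP]; [exact: H| |by rewrite (negbTE ij)].
  by rewrite (H _ _ ji); exact/eqP/(forallP (GP2 j)).
rewrite /bweight -(bigA_distr_big_dep (fun e b => allowed e b)
   (fun e b => bern (q e.1 e.2) b)) /=.
rewrite (eq_bigr (fun e : V * V => if (e.1 < e.2)%N
    then bern (q e.1 e.2) (adj G e.1 e.2) else 1)); last first.
  move=> e _; rewrite /allowed; case: ifP => e12; last exact: sum_bern.
  by rewrite (big_pred1 (adj G e.1 e.2)).
rewrite -(pair_big xpredT xpredT (fun i j : V => if (i < j)%N
    then bern (q i j) (adj G i j) else 1)) /=.
under [in RHS]eq_bigr do rewrite -big_mkcond.
by case: (A G); rewrite ?mul1r ?mul0r.
Qed.

Lemma largest_component_lt f k : (0 < k)%N ->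
  (largest_component (graph_of f) < k)%N = all_small k f [set: V].
Proof.
have cE v : component_in f [set: V] v = [set j | connect (adj (graph_of f)) v j].
  rewrite /component_in reach_connect; apply/setP => x.
  by rewrite !inE (eq_connect (adj_graph_of f)).
case: k => // k _; rewrite ltnS; apply/bigmax_leqP/forall_inP => H.
  by move=> v _; rewrite ltnS cE H ?imset_f.
by move=> C /imsetP[v _ ->]; have := H v (in_setT v); rewrite ltnS cE.
Qed.

End GraphLaw.

(** * Quantitative bounds for a fixed number of nodes *)

Section ExpBounds.
Variable R : realType.
Implicit Types (a b x y X Y : R).

Lemma expR_le_mul a b X Y : expR a <= X -> expR b <= Y -> expR (a + b) <= X * Y.
Proof. by move=> aX bY; rewrite expRD ler_pM // ltW // expR_gt0. Qed.

Lemma expR_le_exp a X n : expR a <= X -> expR (n%:R * a) <= X ^+ n.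
Proof.
by move=> aX; rewrite expRM_natl lerXn2r ?nnegrE ?expR_ge0 ?(le_trans (expR_ge0 a)).
Qed.

Lemma one_sub_ge_expR x : 0 <= x <= 1 / 2 -> expR (- (x + 2 * x ^+ 2)) <= 1 - x.
Proof.
move=> /andP[x0 x2]; have x1 : 0 < 1 - x by lra.
rewrite expRN invf_ple ?posrE ?expR_gt0 //.
have -> : (1 - x)^-1 = 1 + x / (1 - x) by field; lra.
apply: le_trans (expR_ge1Dx _) _; rewrite ler_expR ler_pdivrMr //.
have -> : (x + 2 * x ^+ 2) * (1 - x) = x + x ^+ 2 * (1 - 2 * x) by ring.
by rewrite lerDl mulr_ge0 ?sqr_ge0 //; lra.
Qed.

Lemma one_sub_ge_expR2 x : 0 <= x <= 1 / 2 -> expR (- (2 * x)) <= 1 - x.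
Proof.
move=> xP; apply: le_trans (one_sub_ge_expR xP); rewrite ler_expR.
by case/andP: xP => x0 x2; nra.
Qed.

Lemma ln_succ_ge m : (0 < m)%N -> m.+1%:R^-1 <= ln (m.+1%:R : R) - ln m%:R.
Proof.
move=> m0; have m0' : 0 < m%:R :> R by rewrite ltr0n.
have m1' : 0 < m.+1%:R :> R by rewrite ltr0n.
have : ln (1 + - m.+1%:R^-1 : R) <= - m.+1%:R^-1.
  apply: le_ln1Dx; rewrite ltrN2 invf_lt1 //.
  by rewrite ltr1n.
have -> : 1 + - m.+1%:R^-1 = m%:R / m.+1%:R :> R.
  by rewrite -natr1; field; rewrite natr1 pnatr_eq0.
by rewrite ln_div ?posrE // => h; rewrite -lerN2 opprB.
Qed.

Lemma natX_expR m j : (0 < m)%N -> (m%:R : R) ^+ j = expR (j%:R * ln m%:R).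
Proof. by move=> m0; rewrite expRM_natl lnK // posrE ltr0n. Qed.

(** A weak Stirling bound, [m! <= e m (m / e)^m]. *)
Lemma pow_fact_ge m : (0 < m)%N ->
  expR (m%:R - 1 - ln m%:R) <= (m%:R : R) ^+ m / m`!%:R.
Proof.
case: m => // m _; elim: m => [|m IH].
  by rewrite ln1 subrr subr0 expR0 expr1 divr1.
have m0 : m.+1%:R != 0 :> R by rewrite pnatr_eq0.
have f0 : (m.+1)`!%:R != 0 :> R by rewrite pnatr_eq0 -lt0n fact_gt0.
have -> : (m.+2%:R : R) ^+ m.+2 / (m.+2)`!%:R =
    (m.+1%:R ^+ m.+1 / (m.+1)`!%:R) *
      expR (m.+1%:R * (ln m.+2%:R - ln m.+1%:R)).
  rewrite (natX_expR m.+1 (ltn0Sn m)) [RHS]mulrAC -expRD.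
  have -> : m.+1%:R * ln m.+1%:R + m.+1%:R * (ln m.+2%:R - ln m.+1%:R) =
     m.+1%:R * ln (m.+2%:R : R) by ring.
  by rewrite -natX_expR // exprS factS natrM -mulf_div divff ?mul1r.
apply: le_trans (expR_le_mul IH (lexx _)); rewrite ler_expR.
have h : 1 <= m.+2%:R * (ln (m.+2%:R : R) - ln m.+1%:R).
  by rewrite mulrC -ler_pdivrMr ?ltr0n // div1r ln_succ_ge.
rewrite -[m.+2%:R]natr1 in h *; nra.
Qed.

Lemma bin_ge u j : (j <= u)%N -> ((u - j)%:R : R) ^+ j / j`!%:R <= 'C(u, j)%:R.
Proof.
move=> ju; rewrite ler_pdivrMr ?ltr0n ?fact_gt0 // -natrM -natrX ler_nat bin_ffact.
elim: j u ju => // j IH [//|u]; rewrite ltnS subSS => ju.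
rewrite ffactSS expnS leq_mul //; last exact: IH.
by rewrite (leq_trans (leq_subr _ _)).
Qed.

(** Stirling turns the tree count into [e^(- m I(l))]. The constant 7 collects 4 from the binomial
    coefficient, 2 from the power of [1 - p] and 1 from Stirling; Stirling and the factor [1 / m]
    cost [ln k] each. *)
Lemma cluster_bound_in_ge (p : R) (n m k u : nat) :
  let l := n%:R * p in
  0 < l <= 1 -> (4 <= k)%N -> (k ^ 2 <= n)%N -> (0 < m <= k)%N ->
  n%:R * (1 - k%:R^-1) <= u%:R :> R ->
  expR (- 7 - 2 * ln k%:R - m%:R * rate l) <= cluster_bound p 1 m u.-1 n.
Proof.
move=> l /andP[l0 l1] k4 kn /andP[m0 mk] un.
have k0 : 0 < k%:R :> R by rewrite ltr0n; lia.
have n0 : 0 < n%:R :> R by rewrite ltr0n; lia.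
have kn' : k%:R <= n%:R / k%:R :> R.
  by rewrite ler_pdivlMr // -natrM ler_nat mulnn.
have p0 : 0 < p by rewrite -(pmulr_rgt0 _ n0).
have k4' : 4 <= k%:R :> R by rewrite ler_nat.
have n4 : k%:R <= n%:R :> R by apply: le_trans kn' _; rewrite ler_pdivrMr // ler_peMr; lra.
have ik : k%:R^-1 <= 1 / 4 :> R.
  by rewrite -[_ / _]invrK lef_pV2 ?posrE //; lra.
have ik0 : 0 < k%:R^-1 :> R by rewrite invr_gt0.
have mk' : m%:R <= k%:R :> R by rewrite ler_nat.
have m1' : 1 <= m%:R :> R by rewrite ler1n.
have um : n%:R * (1 - 2 / k%:R) <= u%:R - m%:R :> R by nra.
have mu : (m <= u)%N.
  rewrite -(ler_nat R) -subr_ge0; apply: le_trans um.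
  by rewrite mulr_ge0 ?ltW //; lra.
have u0 : (0 < u)%N by apply: leq_trans mu.
have C1 : expR (m.-1%:R * (ln n%:R - 4 / k%:R)) <= (u - m)%:R ^+ m.-1 :> R.
  apply: expR_le_exp; rewrite natrB // expRD lnK ?posrE //.
  apply: le_trans um; apply: ler_wpM2l; first exact: ltW.
  rewrite -mulNr; have -> : - 4 / k%:R = - (2 * (2 / k%:R)) :> R by ring.
  by apply: one_sub_ge_expR2; lra.
have C2 : (u - m)%:R ^+ m.-1 / (m.-1)`!%:R <= 'C(u.-1, m.-1)%:R :> R.
  have -> : (u - m = u.-1 - m.-1)%N by rewrite -(subSS m.-1 u.-1) (prednK m0) (prednK u0).
  by apply: bin_ge; rewrite -ltnS (prednK m0) (prednK u0).
have C3 : expR ((m * n)%:R * (- (p + 2 * p ^+ 2))) <= (1 - p) ^+ (m * n) :> R.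
  apply: expR_le_exp; apply: one_sub_ge_expR; rewrite ltW //=.
  have : 2 * p <= n%:R * p by apply: ler_wpM2r; rewrite ?ltW //; lra.
  by move: l1; rewrite /l; lra.
have C4 := pow_fact_ge m0.
have C5 : p ^+ m.-1 = expR (m.-1%:R * ln p) by rewrite expRM_natl lnK.
have lnl : ln l = ln n%:R + ln p by rewrite lnM ?posrE.
rewrite /cluster_bound subn1.
have -> : 'C(u.-1, m.-1)%:R * (1%:R / m%:R) * m%:R ^+ m.-1 * p ^+ m.-1 *
    (1 - p) ^+ (m * n) =
    ('C(u.-1, m.-1)%:R * (m.-1)`!%:R) * (m%:R ^+ m / m`!%:R) * m%:R^-1 * p ^+ m.-1 *
    (1 - p) ^+ (m * n) :> R.
  have f0 : (m.-1)`!%:R != 0 :> R by rewrite pnatr_eq0 -lt0n fact_gt0.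
  have mf : m`!%:R = m%:R * (m.-1)`!%:R :> R.
    by rewrite -natrM; congr _%:R; case: (m) m0.
  have mm : m%:R ^+ m = m%:R * m%:R ^+ m.-1 :> R by rewrite -exprS prednK.
  rewrite mf mm; field.
  by rewrite f0 pnatr_eq0 -lt0n m0.
rewrite ler_pdivrMr ?ltr0n ?fact_gt0 // in C2; have {}C1 := le_trans C1 C2.
have im : expR (- ln m%:R) <= m%:R^-1 :> R by rewrite expRN lnK // posrE; lra.
have := expR_le_mul (expR_le_mul (expR_le_mul (expR_le_mul C1 C4) im)
  (lexx (expR (m.-1%:R * ln p)))) C3.
rewrite -C5; apply: le_trans; rewrite ler_expR /rate lnl.
have lmk : ln m%:R <= ln k%:R :> R by rewrite ler_ln ?posrE //; lra.
have lnl0 : ln n%:R + ln p <= 0 by rewrite -lnl ln_le0.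
rewrite natrM; have -> : m.-1%:R = m%:R - 1 :> R by rewrite -{2}(prednK m0) -natr1 addrK.
have e1 : m%:R * n%:R * (p + 2 * p ^+ 2) <= m%:R * l + 2.
  have -> : m%:R * n%:R * (p + 2 * p ^+ 2) = m%:R * l + 2 * (m%:R * p * l).
    by rewrite /l; ring.
  have mp : m%:R * p <= 1.
    apply: le_trans l1; rewrite /l ler_wpM2r //; first exact: ltW.
    exact: le_trans mk' n4.
  have : m%:R * p * l <= 1 by apply: mulr_ile1 => //; rewrite ltW // mulr_gt0 //; lra.
  lra.
have e2 : (m%:R - 1) * (4 / k%:R) <= 4 :> R.
  by rewrite mulrCA ler_piMr // ler_pdivrMr //; lra.
rewrite /l in e1 *; nra.
Qed.

End ExpBounds.

(** * Large components exist with high probability *)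

Section FiniteBounds.
Variable R : realType.
Implicit Types (x y : R).

(** The largest term of the series of [e^y] is [e^y] up to a constant and a factor [k]. *)
Lemma pow_fact_floor (k j : nat) y : (0 < k)%N -> (j <= k)%N ->
  j%:R <= y < j%:R + 1 -> expR (y - 2 - ln k%:R) <= y ^+ j / j`!%:R.
Proof.
move=> k0 jk /andP[jy yj].
have lk : 0 <= ln k%:R :> R by rewrite ln_ge0 // ler1n.
case: (posnP j) => [j0|j0].
  rewrite j0 expr0 fact0 divr1 -[leRHS]expR0 ler_expR; rewrite j0 in yj.
  by move: yj; rewrite add0r => yj; lra.
have j1 : 1 <= j%:R :> R by rewrite ler1n.
apply: (@le_trans _ _ (j%:R ^+ j / j`!%:R)).
  apply: le_trans (pow_fact_ge R j0); rewrite ler_expR.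
  have : ln j%:R <= ln k%:R :> R by rewrite ler_ln ?posrE ?ler_nat ?ltr0n //; lia.
  lra.
by rewrite ler_wpM2r // lerXn2r ?nnegrE; lra.
Qed.

(** With [j = k - m] the bound is about [(k l)^j / j! = e^(- j I1) (k x)^j / j!] times [e^(- k l)],
    and [j] near [k x] makes [(k x)^j / j!] about [e^(k x)]. Using [k - 1] for [k] costs at most 1;
    [w] close to [N - 3 n] costs [6 k n / N]. *)
Lemma cluster_bound_out_ge (p I1 : R) (N n m k w : nat) :
  let l := N%:R * p in let x := l * expR I1 in
  0 < l <= 1 -> x <= 1 -> (0 < m <= k)%N -> (k <= n)%N -> (6 * n <= N)%N ->
  N%:R - 3 * n%:R + k%:R <= w%:R :> R ->
  (k - m)%:R <= (k%:R - 1) * x < (k - m)%:R + 1 ->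
  expR (- 5 - 2 * ln k%:R - (k - m)%:R * I1 - k%:R * (l - x) -
        6 * (k%:R * (n%:R / N%:R)))
  <= cluster_bound p m k w (N - n).
Proof.
move=> l x /andP[l0 l1] x1 /andP[m0 mk] kn nN wP.
set j := (k - m)%N => jP.
have k0n : (0 < k)%N by apply: leq_trans mk.
have k0 : 0 < k%:R :> R by rewrite ltr0n.
have n0 : 0 < n%:R :> R by rewrite ltr0n; apply: leq_trans kn.
have nN' : 6 * n%:R <= N%:R :> R by rewrite -natrM ler_nat.
have N0 : 0 < N%:R :> R by lra.
have p0 : 0 < p by rewrite -(pmulr_rgt0 _ N0).
have kn' : k%:R <= n%:R :> R by rewrite ler_nat.
have jk : (j <= k)%N by rewrite leq_subr.
have jk' : j%:R <= k%:R :> R by rewrite ler_nat.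
have k1' : 1 <= k%:R :> R by rewrite ler1n.
have jw : (j <= w)%N by rewrite -(ler_nat R); lra.
set d : R := n%:R / N%:R.
have d0 : 0 < d by rewrite divr_gt0.
have d6 : d <= 1 / 6 by rewrite ler_pdivrMr //; lra.
have nE : n%:R = N%:R * d :> R by rewrite /d mulrCA divff ?mulr1 // gt_eqF.
have C1 : expR (j%:R * (ln N%:R - 2 * (3 * d))) <= (w - j)%:R ^+ j :> R.
  apply: expR_le_exp; rewrite natrB // expRD lnK ?posrE //.
  apply: (@le_trans _ _ (N%:R * (1 - 3 * d))).
    by apply: ler_wpM2l; [exact: ltW|apply: one_sub_ge_expR2; lra].
  by rewrite mulrBr mulr1 mulrCA -nE; lra.
have C2 := bin_ge R jw; rewrite ler_pdivrMr ?ltr0n ?fact_gt0 // in C2.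
have {}C1 := le_trans C1 C2.
have C3 : expR ((k * (N - n))%:R * (- (p + 2 * p ^+ 2))) <= (1 - p) ^+ (k * (N - n)) :> R.
  apply: expR_le_exp; apply: one_sub_ge_expR; rewrite ltW //=.
  have : 2 * p <= N%:R * p by apply: ler_wpM2r; rewrite ?ltW //; lra.
  by move: l1; rewrite /l; lra.
have e3 : - (k%:R * l + 2) <= (k * (N - n))%:R * (- (p + 2 * p ^+ 2)).
  rewrite mulrN lerN2 natrM.
  apply: (@le_trans _ _ (k%:R * N%:R * (p + 2 * p ^+ 2))).
    apply: ler_wpM2r; first by rewrite addr_ge0 ?mulr_ge0 ?sqr_ge0 // ltW.
    by rewrite ler_wpM2l ?ler_nat ?leq_subr // ltW.
  have -> : k%:R * N%:R * (p + 2 * p ^+ 2) = k%:R * l + 2 * (k%:R * p * l).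
    by rewrite /l; ring.
  have kp : k%:R * p <= 1.
    by apply: le_trans l1; rewrite /l ler_wpM2r; [| exact: ltW | lra].
  have : k%:R * p * l <= 1 by apply: mulr_ile1; rewrite ?mulr_ge0 // ltW.
  lra.
have C4 := pow_fact_floor k0n jk jP.
have pE : (k%:R * p) ^+ j * expR (j%:R * ln N%:R) = (k%:R * l) ^+ j.
  by rewrite -natX_expR -?(ltr0n R) // -exprMn /l; congr (_ ^+ _); ring.
have kl : ((k%:R - 1) * x) ^+ j * expR (- (j%:R * I1)) <= (k%:R * l) ^+ j.
  rewrite -mulrN expRM_natl -exprMn expRN.
  have -> : (k%:R - 1) * x / expR I1 = (k%:R - 1) * l.
    by rewrite /x; field; rewrite gt_eqF // expR_gt0.
  have k1l : (k%:R - 1) * l <= k%:R * l by apply: ler_wpM2r; [exact: ltW|lra].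
  have k1l0 : 0 <= (k%:R - 1) * l by rewrite mulr_ge0 ?subr_ge0 // ltW.
  by rewrite lerXn2r // nnegrE // (le_trans k1l0).
have f0 : (j`!%:R : R) != 0 by rewrite pnatr_eq0 -lt0n fact_gt0.
rewrite /cluster_bound -/j.
have -> : 'C(w, j)%:R * (m%:R / k%:R) * k%:R ^+ j * p ^+ j * (1 - p) ^+ (k * (N - n)) =
   m%:R * (k%:R^-1 * (('C(w, j)%:R * j`!%:R) * (k%:R * p) ^+ j / j`!%:R)
   * (1 - p) ^+ (k * (N - n))) :> R.
  by rewrite exprMn; field; rewrite f0 gt_eqF.
have ik : expR (- ln k%:R) <= k%:R^-1 :> R by rewrite expRN lnK // posrE.
have E : expR (- (j%:R * (6 * d)) - j%:R * I1 + ((k%:R - 1) * x - 2 - ln k%:R)) <=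
   ('C(w, j)%:R * j`!%:R) * (k%:R * p) ^+ j / j`!%:R :> R.
  apply: (@le_trans _ _ (expR (- (j%:R * (6 * d))) * ((k%:R * l) ^+ j / j`!%:R))).
    have -> : - (j%:R * (6 * d)) - j%:R * I1 + ((k%:R - 1) * x - 2 - ln k%:R) =
      - (j%:R * (6 * d)) + (((k%:R - 1) * x - 2 - ln k%:R) + - (j%:R * I1)) by ring.
    rewrite expRD ler_wpM2l ?expR_ge0 // expRD.
    apply: (@le_trans _ _ (((k%:R - 1) * x) ^+ j / j`!%:R * expR (- (j%:R * I1)))).
      by rewrite ler_wpM2r ?expR_ge0.
    by rewrite mulrAC ler_wpM2r.
  rewrite mulrA ler_wpM2r // -pE.
  have -> : expR (- (j%:R * (6 * d))) * ((k%:R * p) ^+ j * expR (j%:R * ln N%:R)) =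
     expR (j%:R * (ln N%:R - 2 * (3 * d))) * (k%:R * p) ^+ j.
    rewrite mulrCA mulrC -expRD; congr (expR _ * _); ring.
  by rewrite ler_wpM2r // exprn_ge0 // mulr_ge0 // ltW.
have := expR_le_mul (expR_le_mul ik E) C3; set X := (X in _ <= X) => EX.
apply: (@le_trans _ _ X); last first.
  by rewrite ler_peMl ?ler1n // (le_trans _ EX) // expR_ge0.
apply: le_trans EX; rewrite ler_expR.
have jd : j%:R * (6 * d) <= 6 * (k%:R * d).
  by rewrite mulrCA ler_wpM2l // ler_wpM2r // ltW.
have := e3; set Y := _ * - _; move=> e3'.
nra.
Qed.

Lemma one_sub_exp_le (q a : R) (M : nat) : expR a <= M%:R * q ->
  (Num.max 0 (1 - q)) ^+ M <= expR (- expR a).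
Proof.
move=> aq.
have h : Num.max 0 (1 - q) <= expR (- q).
  by rewrite ge_max expR_ge0 (le_trans _ (expR_ge1Dx _)).
apply: (@le_trans _ _ (expR (- q) ^+ M)).
  by rewrite lerXn2r ?nnegrE ?expR_ge0 // le_max lexx.
by rewrite -expRM_natl ler_expR mulrN lerN2.
Qed.

Lemma trials_ge (n k : nat) : (0 < k)%N -> (k ^ 2 <= n)%N ->
  exists2 M, expR (ln n%:R - 1 - 2 * ln k%:R) <= M%:R :> R & (M * k * k <= n)%N.
Proof.
(* So many trials use at most [n / k] vertices. The integer part loses a factor of at most 2, which
   is less than [e]. *)
move=> k0 kn; exists (n %/ k ^ 2)%N; last by rewrite -mulnA mulnn leq_trunc_div.
 have k20 : (0 < k ^ 2)%N by rewrite expn_gt0 k0.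
have n0 : (0 < n)%N by apply: leq_trans kn.
have lk : expR (2 * ln k%:R) = (k ^ 2)%:R :> R.
  by rewrite natrX expRM_natl lnK // posrE ltr0n.
rewrite expRD expRD lnK ?posrE ?ltr0n // [expR (- (2 * _))]expRN lk.
rewrite ler_pdivrMr ?ltr0n //.
have : (n <= 2 * (n %/ k ^ 2 * k ^ 2))%N.
  have M1 : (0 < n %/ k ^ 2)%N by rewrite divn_gt0.
  have := ltn_ceil n k20; rewrite mulSn => H.
  by rewrite mul2n -addnn (leq_trans (ltnW H)) // leq_add2r leq_pmull.
rewrite -natrM -(ler_nat R) natrM => H.
have e1 : expR (-1) <= 1 / 2 :> R.
  rewrite expRN -div1r ler_pdivrMr ?expR_gt0 //.
  by have := expR_ge1Dx (1 : R); lra.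
have n0' : 0 < n%:R :> R by rewrite ltr0n.
nra.
Qed.

(** The number of trials times the success probability: [13 = 1 + 7 + 5], each factor costs
    [2 ln k], and the two uses of [rate l1] add up to [k * rate l1]. *)
Lemma planted_all_small_le (N k : nat) (p0 p1 : R) (S : {set 'I_N}) :
  let n := #|S| in
  let l0 := N%:R * p0 in let l1 := n%:R * p1 in
  0 < l0 <= 1 -> 0 < l1 <= 1 -> l0 * expR (rate l1) <= 1 ->
  (4 <= k)%N -> (k ^ 2 <= n)%N -> (6 * n <= N)%N ->
  bprob (planted p0 p1 S) (fun f => all_small k f [set: 'I_N]) <=
  expR (- expR (ln n%:R - 13 - 6 * ln k%:R -
    k%:R * (l0 + rate l1 - l0 * expR (rate l1)) -
    6 * (k%:R * (n%:R / N%:R)))).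
Proof.
move=> n l0 l1 l0P l1P xP k4 kn nN.
have k0 : (0 < k)%N by apply: leq_trans k4.
have kk : (k <= n)%N by apply: leq_trans kn; rewrite -mulnn leq_pmull.
have n0 : (0 < n)%N by apply: leq_trans kk.
have N0 : (0 < N)%N by lia.
have k1' : 1 <= k%:R :> R by rewrite ler1n.
set x := l0 * expR (rate l1).
have x0 : 0 < x by rewrite mulr_gt0 ?expR_gt0 //; case/andP: l0P.
have prob (m : nat) (p : R) : (0 < m)%N -> 0 < m%:R * p <= 1 -> 0 <= p <= 1.
  move=> m0 /andP[mp0 mp1]; have m0' : 0 < m%:R :> R by rewrite ltr0n.
  have p0' : 0 < p by rewrite -(pmulr_rgt0 _ m0').
  by rewrite ltW //= (le_trans _ mp1) // ler_peMl ?ler1n // ltW.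
(* The forest gets [j] vertices, the integer part of [(k - 1) x]; since [x <= 1] this leaves [m > 0]
   vertices for the cluster inside [S]. *)
set y := (k%:R - 1) * x.
have y0 : 0 <= y by rewrite mulr_ge0 ?subr_ge0 // ltW.
have yk : y <= k%:R - 1 by rewrite ler_piMr // subr_ge0.
pose j := Num.truncn y.
have jP : j%:R <= y < j%:R + 1.
  by have := truncn_itv y0; rewrite natr1.
have jk : (j < k)%N.
  rewrite -(ltr_nat R); case/andP: jP => jy _; apply: le_lt_trans jy _.
  by apply: le_lt_trans yk _; rewrite gtrBl.
pose m := (k - j)%N; have mP : (0 < m <= k)%N by rewrite subn_gt0 jk leq_subr.
have kmj : (k - m = j)%N by rewrite subKn // ltnW.
have [M trial Mk] := trials_ge k0 kn.
have Mk' : (M * k)%:R <= n%:R / k%:R :> R.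
  by rewrite ler_pdivlMr ?ltr0n // -natrM ler_nat.
have Mkn : (M * k <= n)%N by apply: leq_trans Mk; rewrite leq_pmulr.
have Mkn2 : (2 * (M * k) <= n)%N.
  by apply: leq_trans Mk; rewrite mulnC leq_mul2l (leq_trans _ k4) ?orbT.
have k2n : (2 * k <= n)%N.
  by apply: leq_trans kn; rewrite -mulnn leq_mul2r (leq_trans _ k4) ?orbT.
pose u := (n - M * k)%N; pose w := (N - n - M * k)%N.
have c1 : expR (- 7 - 2 * ln k%:R - m%:R * rate l1) <= cluster_bound p1 1 m u.-1 n.
  apply: cluster_bound_in_ge => //; rewrite /u natrB //.
  by rewrite mulrBr mulr1 lerB.
have c2 : expR (- 5 - 2 * ln k%:R - (k - m)%:R * rate l1 - k%:R * (l0 - x) -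
        6 * (k%:R * (n%:R / N%:R))) <= cluster_bound p0 m k w (N - n).
  apply: cluster_bound_out_ge => //; last by rewrite kmj.
  have -> : 3 * n%:R = (3 * n)%:R :> R by rewrite natrM.
  rewrite -natrB; last by move: nN; clear; lia.
  by rewrite -natrD ler_nat /w; move: nN Mkn2 k2n; clear; lia.
have cc := expR_le_mul c1 c2.
have tc := expR_le_mul trial cc.
apply: (@le_trans _ _ ((Num.max 0 (1 - cluster_bound p1 1 m u.-1 n *
    cluster_bound p0 m k w (N - n))) ^+ M)).
  apply: (planted_all_small (m := m) (u := u) (w := w)) => //.
  - exact: (prob N p0 N0 l0P).
  - exact: (prob n p1 n0 l1P).
  - by rewrite /u; move: Mkn2 n0; clear; lia.
  - by rewrite /u subnK.
  - by rewrite le_max lexx.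
  - by rewrite le_max lexx orbT.
apply: one_sub_exp_le; apply: le_trans tc; rewrite ler_expR.
have -> : m%:R = k%:R - (k - m)%:R :> R by rewrite -natrB ?leq_subr // kmj.
by rewrite /x; lra.
Qed.

(** The null graph is planted on all nodes with [p1 = p0]; with [m = k] there is no forest and the
    second cluster bound is 1. *)
Lemma null_all_small_bound (N k : nat) (p0 : R) (S : {set 'I_N}) :
  let l0 := N%:R * p0 in
  0 < l0 <= 1 -> (4 <= k)%N -> (k ^ 2 <= N)%N ->
  bprob (planted p0 p0 S) (fun f => all_small k f [set: 'I_N]) <=
  expR (- expR (ln N%:R - 8 - 4 * ln k%:R - k%:R * rate l0)).
Proof.
move=> l0 l0P k4 kN.
have k0 : (0 < k)%N by apply: leq_trans k4.
have k1' : 1 <= k%:R :> R by rewrite ler1n.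
have kk : (k <= N)%N by apply: leq_trans kN; rewrite -mulnn leq_pmull.
have N0 : (0 < N)%N by apply: leq_trans kk.
have N0' : 0 < N%:R :> R by rewrite ltr0n.
have p0P : 0 <= p0 <= 1.
  move: l0P => /andP[l1 l2]; have p0' : 0 < p0 by rewrite -(pmulr_rgt0 _ N0').
  by rewrite ltW //= (le_trans _ l2) // ler_peMl ?ler1n // ltW.
have [M trial Mk] := trials_ge k0 kN.
have Mk' : (M * k)%:R <= N%:R / k%:R :> R.
  by rewrite ler_pdivlMr ?ltr0n // -natrM ler_nat.
have Mkn2 : (2 * (M * k) <= N)%N.
  by apply: leq_trans Mk; rewrite mulnC leq_mul2l (leq_trans _ k4) ?orbT.
pose u := (N - M * k)%N.
have MkN : (M * k <= N)%N by move: Mkn2; clear; lia.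
have c1 : expR (- 7 - 2 * ln k%:R - k%:R * rate l0) <= cluster_bound p0 1 k u.-1 N.
  apply: cluster_bound_in_ge => //; first by rewrite k0 leqnn.
  by rewrite /u natrB // mulrBr mulr1 lerB.
have tc := expR_le_mul trial c1.
apply: (@le_trans _ _ ((Num.max 0 (1 - cluster_bound p0 1 k u.-1 N)) ^+ M)).
  have -> : bprob (planted p0 p0 S) (fun f => all_small k f [set: 'I_N]) =
      bprob (planted p0 p0 [set: 'I_N]) (fun f => all_small k f [set: 'I_N]).
    apply: (eq_bexp_on (J := [set: 'I_N * 'I_N])) => [e _|f g fg].
      by rewrite /planted !if_same.
    by have -> : f = g by apply/ffunP => e; apply: fg; rewrite inE.
  apply: (planted_all_small (m := k) (u := u) (w := 0%N)) => //.
  - by rewrite k0 leqnn.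
  - by rewrite /u; move: Mkn2 N0; clear; lia.
  - by rewrite cardsT card_ord /u subnK.
  - by rewrite le_max lexx.
  rewrite cardsT card_ord subnn /cluster_bound !subnn muln0 !expr0 bin0.
  by rewrite divff ?gt_eqF ?ltr0n // !mulr1 le_max lexx orbT.
apply: one_sub_exp_le; apply: le_trans tc; rewrite ler_expR.
by lra.
Qed.

End FiniteBounds.

(** * Tails of the component sizes and the risk of the test *)

Section TailsAndRisk.
Variables (R : realType) (N : nat).
Local Notation V := 'I_N.
Implicit Types (p t : R) (S : {set V}) (k : nat).

Lemma rate_ge0 (x : R) : 0 < x -> 0 <= rate x.
Proof.
move=> x0; have : ln (1 + (x - 1)) <= x - 1 by apply: le_ln1Dx; lra.
by rewrite /rate addrC subrK; lra.
Qed.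

Lemma expR1_le4 : expR 1 <= 4 :> R.
Proof.
have h : 1 / 2 <= expR (- (1 / 2)) :> R.
  by have := expR_ge1Dx (- (1 / 2) : R); lra.
have e : expR 1 * (expR (- (1 / 2)) * expR (- (1 / 2))) = 1 :> R.
  rewrite -!expRD (_ : _ + _ = 0) ?expR0 //; lra.
have h2 : 1 / 4 <= expR (- (1 / 2)) * expR (- (1 / 2)) :> R.
  have -> : 1 / 4 = 1 / 2 * (1 / 2) :> R by lra.
  by apply: ler_pM => //; lra.
by have := ler_wpM2l (expR_ge0 (1 : R)) h2; rewrite e; lra.
Qed.

Lemma prod_add1_le_expR (I : finType) (a : I -> R) : (forall i, 0 <= a i) ->
  \prod_i (1 + a i) <= expR (\sum_i a i).
Proof.
move=> a0; rewrite (big_morph expR (@expRD R) (@expR0 R)).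
by apply: ler_prod => i _; rewrite expR_ge1Dx addr_ge0.
Qed.

Lemma bprob_not_all_small q k : is_prob q ->
  bprob q (fun f => ~~ all_small k f [set: V]) <=
  \sum_v bprob q (fun f => k <= #|component_in f [set: V] v|)%N :> R.
Proof.
move=> qP; apply: le_trans (bprob_exists _ _ qP); apply: le_bprob => // f.
rewrite negb_forall => /existsP[v]; rewrite negb_imply -leqNgt => /andP[_ kv].
by apply/existsP; exists v.
Qed.

Lemma null_tail_le p0 S k : let l0 := N%:R * p0 in 0 < l0 < 1 -> p0 <= 1 ->
  bprob (planted p0 p0 S) (fun f => ~~ all_small k f [set: V]) <=
  expR (ln N%:R - ln l0 - k%:R * rate l0).
Proof.
move=> l0 /andP[l0_gt0 l0_lt1] p01.
have N0 : 0 < N%:R :> R.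
  by rewrite lt0r ler0n andbT; apply: contraTneq l0_gt0; rewrite /l0 => ->; rewrite mul0r ltxx.
have p00 : 0 <= p0 by rewrite -(pmulr_rge0 _ N0) ltW.
have p0P : 0 <= p0 <= 1 by rewrite p00.
have qP := planted_prob S p0P p0P.
have y1 : 1 <= l0^-1 by rewrite invf_ge1 // ltW.
apply: le_trans (bprob_not_all_small _ qP) _.
(* Once the product is bounded by an exponential, [y = 1 / l0] solves the recursion with equality:
   [rate l0 + l0 (1 / l0 - 1) = - ln l0]. *)
have h v : bprob (planted p0 p0 S) (fun f => k <= #|component_in f [set: V] v|)%N <=
    l0^-1 / expR (rate l0) ^+ k.
  apply: (bprob_component_ge (y := fun=> l0^-1)) => // [|a].
    by rewrite -expR0 ler_expR rate_ge0.
  apply: (@le_trans _ _ (expR (rate l0) * expR (\sum_(x < N) p0 * (l0^-1 - 1)))).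
    rewrite ler_wpM2l ?expR_ge0 //.
    under eq_bigr do rewrite planted_edge if_same.
    by apply: prod_add1_le_expR => x; rewrite mulr_ge0 ?subr_ge0.
  rewrite -expRD sumr_const card_ord -mulr_natl mulrA -/l0 mulrBr mulr1.
  rewrite divff ?gt_eqF // /rate -[leRHS]lnK ?posrE ?invr_gt0 // ler_expR lnV ?posrE //.
  lra.
apply: le_trans (ler_sum _ (fun v _ => h v)) _.
rewrite sumr_const card_ord -[leLHS]mulr_natl; apply: ler_eq.
rewrite expRD expRD lnK ?posrE // [expR (- ln _)]expRN lnK ?posrE //.
by rewrite [expR (- _)]expRN expRM_natl mulrA.
Qed.

(** The last two hypotheses are the recursion for a vertex in [S] and outside it, in logarithms and
    after [1 + a <= e^a]. *)
Lemma planted_tail_le p0 p1 S k (th y0 y1 : R) :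
  let n := #|S| in
  0 <= p0 <= 1 -> 0 <= p1 <= 1 -> 0 <= th -> 1 <= y0 -> 1 <= y1 ->
  th + n%:R * p1 * (y1 - 1) + N%:R * p0 * (y0 - 1) <= ln y1 ->
  th + n%:R * p0 * (y1 - 1) + N%:R * p0 * (y0 - 1) <= ln y0 ->
  \sum_(v in S) bprob (planted p0 p1 S) (fun f => k <= #|component_in f [set: V] v|)%N <=
  n%:R * y1 * expR (- (k%:R * th)).
Proof.
move=> n p0P p1P th0 y0_ge1 y1_ge1 H1 H0.
have qP := planted_prob S p0P p1P.
have y0_gt0 : 0 < y0 by apply: lt_le_trans y0_ge1.
have y1_gt0 : 0 < y1 by apply: lt_le_trans y1_ge1.
have [/andP[p00 _] /andP[p10 _]] := (p0P, p1P).
have S_le : #|~: S|%:R <= N%:R :> R.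
  by rewrite ler_nat (leq_trans (max_card _)) // card_ord.
have sumE a :
    \sum_(x < N) planted p0 p1 S (edge a x) * ((if x \in S then y1 else y0) - 1) <=
    n%:R * (if a \in S then p1 else p0) * (y1 - 1) + N%:R * p0 * (y0 - 1).
  rewrite (bigID (fun x => x \in S)) /=; apply: lerD.
    rewrite (eq_bigr (fun=> (if a \in S then p1 else p0) * (y1 - 1))); last first.
      by move=> x xS; rewrite planted_edge xS andbT.
    by rewrite sumr_const -[leLHS]mulr_natl mulrA.
  rewrite (eq_bigr (fun=> p0 * (y0 - 1))); last first.
    by move=> x xS; rewrite planted_edge (negbTE xS) andbF.
  rewrite sumr_const -[leLHS]mulr_natl -mulrA; apply: ler_wpM2r.
    by rewrite mulr_ge0 ?subr_ge0.
  apply: le_trans S_le; rewrite ler_nat; apply: subset_leq_card.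
  by apply/subsetP => x; rewrite !inE.
have h v : v \in S ->
    bprob (planted p0 p1 S) (fun f => k <= #|component_in f [set: V] v|)%N <=
    y1 / expR th ^+ k.
  move=> vS; have := @bprob_component_ge _ _ (planted p0 p1 S)
    (fun x => if x \in S then y1 else y0) (expR th) k [set: V] v qP.
  rewrite vS; apply.
  - by rewrite -expR0 ler_expR.
  - by move=> x; case: ifP.
  move=> a; apply: (@le_trans _ _ (expR th * expR (\sum_(x < N)
      planted p0 p1 S (edge a x) * ((if x \in S then y1 else y0) - 1)))).
    rewrite ler_wpM2l ?expR_ge0 //; apply: prod_add1_le_expR => x.
    rewrite mulr_ge0 //; first by case/andP: (qP (edge a x)).
    by case: ifP; rewrite subr_ge0.
  rewrite -expRD; apply: (@le_trans _ _ (expR (ln (if a \in S then y1 else y0)))).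
    rewrite ler_expR; apply: le_trans (lerD (lexx th) (sumE a)) _.
    by rewrite addrA; case: ifP.
  by case: ifP; rewrite lnK ?posrE.
apply: le_trans (ler_sum _ h) _.
by rewrite sumr_const -[leLHS]mulr_natl expRN expRM_natl mulrA.
Qed.

(* The generating function is evaluated at 1 / l0 outside S, as in the null
   case: the vertices of S do not change the rate when l1 e^(1 - l1) <= l0. *)
Lemma planted_tail_null_regime p0 p1 S k :
  let n := #|S| in let l0 := N%:R * p0 in let l1 := n%:R * p1 in
  0 <= p0 <= 1 -> 0 <= p1 <= 1 -> 0 < l0 < 1 -> l1 < 1 ->
  l1 * expR (1 - l1) <= l0 -> 4 * (n%:R / N%:R) <= rate l0 ->
  \sum_(v in S) bprob (planted p0 p1 S) (fun f => k <= #|component_in f [set: V] v|)%N <=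
  expR (ln n%:R + 1 - ln l0 - k%:R * rate l0 + 4 * (k%:R * (n%:R / N%:R))).
Proof.
move=> n l0 l1 p0P p1P /andP[l0_gt0 l0_lt1] l1_lt1 l10 nN.
have [n0|n_gt0] := posnP n.
  rewrite big_pred0 ?expR_ge0 // => v.
  by rewrite (cards0_eq n0) inE.
have [/andP[p00 _] /andP[p10 _]] := (p0P, p1P).
have n0' : 0 < n%:R :> R by rewrite ltr0n.
have N0 : 0 < N%:R :> R.
  by rewrite ltr0n (leq_trans n_gt0) // /n (leq_trans (max_card _)) // card_ord.
have l1_ge0 : 0 <= l1 by rewrite mulr_ge0.
(* For vertices of [S] this value solves the recursion as soon as [l1 * y1 <= 1], which is the
   assumption of the regime. *)
pose y1 := expR (1 - l1) / l0.
have e4 : expR (1 - l1) <= 4 by apply: le_trans expR1_le4; rewrite ler_expR; lra.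
have y1_ge1 : 1 <= y1.
  rewrite ler_pdivlMr // mul1r (le_trans (ltW l0_lt1)) // -[leLHS]expR0 ler_expR; lra.
(* The influence of [S] on an outside vertex, to be subtracted from the rate. *)
have ny1 : n%:R * p0 * (y1 - 1) <= 4 * (n%:R / N%:R).
  apply: (@le_trans _ _ (n%:R * p0 * (4 / l0))).
    apply: ler_wpM2l; first by rewrite mulr_ge0.
    apply: (@le_trans _ _ y1); first by lra.
    by apply: ler_wpM2r; rewrite // invr_ge0 ltW.
  apply: ler_eq; rewrite /l0; field; rewrite gt_eqF //=.
  by rewrite gt_eqF // -(pmulr_rgt0 _ N0).
have ly1 : ln y1 = 1 - l1 - ln l0 by rewrite ln_div ?posrE ?expR_gt0 // expRK.
have ly0 : ln l0^-1 = - ln l0 by rewrite lnV ?posrE.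
have l0V : l0 * (l0^-1 - 1) = 1 - l0 by rewrite mulrBr divff ?gt_eqF // mulr1.
have l1y1 : l1 * y1 <= 1 by rewrite /y1 mulrA ler_pdivrMr // mul1r.
apply: le_trans (planted_tail_le (th := rate l0 - n%:R * p0 * (y1 - 1))
  (y0 := l0^-1) (y1 := y1) k p0P p1P _ _ y1_ge1 _ _) _; rewrite -/n -/l0 -/l1.
- by rewrite subr_ge0 (le_trans ny1).
- by rewrite invf_ge1 // ltW.
- rewrite l0V ly1 mulrBr mulr1 /rate.
  have : 0 <= n%:R * p0 * (y1 - 1) by rewrite !mulr_ge0 ?subr_ge0 // ltW.
  lra.
- by rewrite l0V ly0 /rate; lra.
have y10 : 0 < y1 by apply: lt_le_trans y1_ge1.
have -> : n%:R * y1 = expR (ln n%:R + ln y1) by rewrite expRD !lnK ?posrE.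
rewrite -expRD ly1.
rewrite ler_expR mulrBr.
have := ler_wpM2l (ler0n R k) ny1; rewrite [leRHS]mulrCA; lra.
Qed.

(** The values [1 / l1] in [S] and [e^I(l1)] outside solve both recursions with rate [D] and
    equality, apart from the influence of [S] on outside vertices, which lowers the rate
    slightly. *)
Lemma planted_tail_mixed_regime p0 p1 S k :
  let n := #|S| in let l0 := N%:R * p0 in let l1 := n%:R * p1 in
  let D := l0 + rate l1 - l0 * expR (rate l1) in
  0 <= p0 <= 1 -> 0 <= p1 <= 1 -> 0 < l0 -> 0 < l1 < 1 ->
  l0 <= l1 * expR (1 - l1) -> 4 * (n%:R / N%:R) <= D ->
  \sum_(v in S) bprob (planted p0 p1 S) (fun f => k <= #|component_in f [set: V] v|)%N <=
  expR (ln n%:R + 2 + D - k%:R * D + 4 * (k%:R * (n%:R / N%:R))).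
Proof.
move=> n l0 l1 D p0P p1P l0_gt0 /andP[l1_gt0 l1_lt1] l01 nN.
have n0' : 0 < n%:R :> R.
  by rewrite lt0r ler0n andbT; apply: contraTneq l1_gt0; rewrite /l1 => ->; rewrite mul0r ltxx.
have N0 : 0 < N%:R :> R.
  by rewrite lt0r ler0n andbT; apply: contraTneq l0_gt0; rewrite /l0 => ->; rewrite mul0r ltxx.
have [/andP[p00 _] /andP[p10 _]] := (p0P, p1P).
have e4 : expR (1 - l1) <= 4 by apply: le_trans expR1_le4; rewrite ler_expR; lra.
have I1_ge0 := rate_ge0 l1_gt0.
have y1_ge1 : 1 <= l1^-1 by rewrite invf_ge1 // ltW.
have rateE : expR (- rate l1) = l1 * expR (1 - l1).
  rewrite -{2}(lnK (x := l1)) ?posrE // -expRD; congr expR; rewrite /rate; lra.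
have x1 : l0 * expR (rate l1) <= 1.
  by rewrite -ler_pdivlMr ?expR_gt0 // div1r -expRN rateE.
have ny1 : n%:R * p0 * (l1^-1 - 1) <= 4 * (n%:R / N%:R).
  apply: (@le_trans _ _ (n%:R * p0 * l1^-1)).
    by apply: ler_wpM2l; [rewrite mulr_ge0|lra].
  rewrite ler_pdivrMr //.
  have -> : n%:R * p0 = (n%:R / N%:R) * l0.
    by rewrite /l0; field; rewrite gt_eqF.
  rewrite [4 * _]mulrC -[leRHS]mulrA; apply: ler_wpM2l; first by rewrite divr_ge0.
  apply: le_trans l01 _; rewrite mulrC.
  by apply: ler_wpM2r; [exact: ltW|].
have ly1 : ln l1^-1 = - ln l1 by rewrite lnV ?posrE.
have l1V : l1 * (l1^-1 - 1) = 1 - l1 by rewrite mulrBr divff ?gt_eqF // mulr1.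
apply: le_trans (planted_tail_le (th := D - n%:R * p0 * (l1^-1 - 1))
  (y0 := expR (rate l1)) (y1 := l1^-1) k p0P p1P _ _ y1_ge1 _ _) _; rewrite -/n -/l0 -/l1.
- by rewrite subr_ge0 (le_trans ny1).
- by rewrite -expR0 ler_expR.
- rewrite l1V ly1 /D mulrBr mulr1.
  have : 0 <= n%:R * p0 * (l1^-1 - 1) by rewrite !mulr_ge0 ?subr_ge0 // ltW.
  by rewrite /rate; lra.
- by rewrite expRK /D; lra.
have y10 : 0 < l1^-1 by apply: lt_le_trans y1_ge1.
have -> : n%:R / l1 = expR (ln n%:R + ln l1^-1).
  by rewrite expRD !lnK ?posrE.
rewrite -expRD ly1.
rewrite ler_expR mulrBr.
have := ler_wpM2l (ler0n R k) ny1; rewrite [leRHS]mulrCA.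
(* Since [- ln l1 = rate l1 + 1 - l1] and [l0 * expR (rate l1) <= 1]. *)
have : - ln l1 <= D + 2 by rewrite /D; move: x1; rewrite /rate; lra.
lra.
Qed.

Lemma le_bprob_all_small p0 p1 p1' S k : 0 <= p0 <= 1 -> 0 <= p1 <= 1 ->
  0 <= p1' <= 1 -> p1' <= p1 ->
  bprob (planted p0 p1 S) (fun f => all_small k f [set: V]) <=
  bprob (planted p0 p1' S) (fun f => all_small k f [set: V]).
Proof.
move=> p0P p1P p1P' p1'1; apply: bexp_antimono; try exact: planted_prob.
  by move=> e; rewrite /planted; case: ifP.
move=> f g fg; rewrite ler_nat.
suff : all_small k g [set: V] ==> all_small k f [set: V].
  by case: (all_small k g _) => //= ->.
apply/implyP => /forall_inP sg; apply/forall_inP => v vV.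
apply: leq_ltn_trans (sg v vV); apply: subset_leq_card; apply: reach_mono => //.
by move=> y z /andP[yz /fg fyz]; rewrite /ad yz.
Qed.

(** On integers a real critical value acts as its ceiling, or as 0 when it is negative; then the
    upper bound may fail, whence the guard. *)
Lemma nat_threshold t : exists k : nat,
  [/\ forall m : nat, (t <= m%:R) = (k <= m)%N, t <= k%:R &
      (0 < k)%N -> k%:R < t + 1].
Proof.
have ex : exists m : nat, t <= m%:R.
  exists (Num.bound `|t|); apply: le_trans (ler_norm t) _.
  by apply: ltW; apply: archi_boundP; exact: normr_ge0.
exists (ex_minn ex); case: ex_minnP => k tk kmin; split => //.
  move=> m; apply/idP/idP => [/kmin //|km].
  by apply: le_trans tk _; rewrite ler_nat.
case: k tk kmin => // k tk kmin _; rewrite -natr1 ltrD2r ltNge.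
by apply/negP => /kmin; rewrite ltnn.
Qed.

Lemma null_prE p0 S (A : pred (sgraph N)) :
  null_pr p0 A = bprob (planted p0 p0 S) (fun f => A (graph_of f)).
Proof.
rewrite /null_pr graph_prE; apply: (eq_bexp_on (J := [set: V * V])) => [e _|f g fg].
  by rewrite /planted if_same.
by have -> : f = g by apply/ffunP => e; apply: fg; rewrite inE.
Qed.

Lemma planted_prE p0 p1 S (A : pred (sgraph N)) :
  planted_pr p0 p1 S A = bprob (planted p0 p1 S) (fun f => A (graph_of f)).
Proof. exact: graph_prE. Qed.

Local Notation test t := (fun G : sgraph N => t <= (largest_component G)%:R).

Lemma null_testE p0 S t k : (0 < k)%N -> (forall m : nat, (t <= m%:R) = (k <= m)%N) ->
  null_pr p0 (test t) =
  bprob (planted p0 p0 S) (fun f => ~~ all_small k f [set: V]).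
Proof.
move=> k0 kP; rewrite (null_prE p0 S); apply: eq_bexp => f.
by rewrite kP -largest_component_lt // -leqNgt.
Qed.

Lemma planted_testE p0 p1 S t k :
  (0 < k)%N -> (forall m : nat, (t <= m%:R) = (k <= m)%N) ->
  planted_pr p0 p1 S (fun G => ~~ test t G) =
  bprob (planted p0 p1 S) (fun f => all_small k f [set: V]).
Proof.
move=> k0 kP; rewrite planted_prE; apply: eq_bexp => f.
by rewrite kP -largest_component_lt // -ltnNge.
Qed.

Lemma risk_powerful_le (n k : nat) p0 p1 t (kap : R) :
  let l0 := N%:R * p0 in let l1 := n%:R * p1 in
  (forall m : nat, (t <= m%:R) = (k <= m)%N) ->
  0 < l0 < 1 -> 0 <= p1 <= 1 -> (4 <= k)%N -> (k ^ 2 <= n)%N -> (6 * n <= N)%N ->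
  (1 <= l1 /\ 0 <= kap) \/ (0 < l1 <= 1 /\ l0 * expR (rate l1) <= 1 /\
     k%:R * (l0 + rate l1 - l0 * expR (rate l1)) <= kap) ->
  risk n p0 p1 (test t) <=
  expR (ln N%:R - ln l0 - k%:R * rate l0) +
  expR (- expR (ln n%:R - 13 - 6 * ln k%:R - kap - 6 * (k%:R * (n%:R / N%:R)))).
Proof.
move=> l0 l1 kP /andP[l0_gt0 l0_lt1] p1P k4 kn nN hyp.
have k0 : (0 < k)%N by apply: leq_trans k4.
have n0 : (0 < n)%N by apply: leq_trans kn; rewrite expn_gt0 k0.
have n0' : 0 < n%:R :> R by rewrite ltr0n.
have N0 : (0 < N)%N by move: nN n0; clear; lia.
have N0' : 0 < N%:R :> R by rewrite ltr0n.
have p0P : 0 <= p0 <= 1.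
  have p00 : 0 < p0 by rewrite -(pmulr_rgt0 _ N0').
  by rewrite ltW //= (le_trans _ (ltW l0_lt1)) // ler_peMl ?ler1n // ltW.
rewrite /risk (null_testE p0 set0 k0 kP); apply: lerD.
  apply: null_tail_le; first exact/andP.
  by case/andP: p0P.
apply: bigmax_le => [|S /eqP Sn]; first exact: expR_ge0.
rewrite (planted_testE p0 p1 S k0 kP).
have l0P : 0 < l0 <= 1 by rewrite l0_gt0 ltW.
case: hyp => [[l1_ge1 kap0]|[l1P [x1 kD]]].
  (* The monotone coupling lowers [p1] to [1 / n], so that [l1] becomes 1 and the cost [D]
     vanishes. *)
  have n1 : n%:R * n%:R^-1 = 1 :> R by rewrite divff ?gt_eqF.
  have rate1 : rate (1 : R) = 0 by rewrite /rate ln1; lra.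
  apply: le_trans (le_bprob_all_small (p1' := n%:R^-1) S k p0P p1P _ _) _.
  - by rewrite invr_ge0 ler0n invf_le1 // ler1n.
  - by rewrite -div1r ler_pdivrMr // mulrC.
  apply: le_trans (planted_all_small_le _ _ _ _ _ _) _;
    rewrite ?Sn ?n1 ?rate1 ?expR0 ?mulr1 ?ltr01 ?lexx //.
    by rewrite ltW.
  by rewrite ler_expR lerN2 ler_expR; lra.
apply: le_trans (planted_all_small_le _ _ _ _ _ _) _; rewrite ?Sn //.
rewrite ler_expR lerN2 ler_expR; move: kD; rewrite -/l0 -/l1.
by move: (k%:R * (_ - _)) => Z; lra.
Qed.

(** A critical value of at least [k] separates the laws only through components meeting [S], at a
    gain of at most [a]; a smaller one makes the test reject under the null with probability at
    least [1 - b]. *)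
Lemma risk_powerless_ge (n k : nat) p0 p1 t (a b : R) (S : {set V}) :
  #|S| = n -> (0 < k)%N -> 0 <= p0 <= 1 -> 0 <= p1 <= 1 ->
  \sum_(v in S) bprob (planted p0 p1 S) (fun f => k <= #|component_in f [set: V] v|)%N <= a ->
  bprob (planted p0 p0 S) (fun f => all_small k f [set: V]) <= b ->
  1 - a - b <= risk n p0 p1 (test t).
Proof.
move=> Sn k0 p0P p1P aP bP.
have qP := planted_prob S p0P p1P; have qP0 := planted_prob S p0P p0P.
have a0 : 0 <= a.
  by apply: le_trans aP; apply: sumr_ge0 => v _; exact: bprob_ge0.
have b0 : 0 <= b by apply: le_trans bP; exact: bprob_ge0.
have riskS : null_pr p0 (test t) + planted_pr p0 p1 S (fun G => ~~ test t G) <=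
    risk n p0 p1 (test t).
  by rewrite lerD2l; apply: le_bigmax_cond; exact/eqP.
apply: le_trans riskS.
have [c [cP _ _]] := nat_threshold t.
have [c0|c_gt0] := posnP c.
  rewrite (null_prE p0 S) planted_prE.
  have -> : bprob (planted p0 p0 S) (fun f => test t (graph_of f)) = 1.
    by rewrite -[RHS](bexp_cst (planted p0 p0 S)); apply: eq_bexp => f; rewrite cP c0.
  have := bprob_ge0 (fun f => ~~ test t (graph_of f)) qP; lra.
rewrite (null_testE p0 S c_gt0 cP) (planted_testE p0 p1 S c_gt0 cP) bprobC.
have [kc|ck] := leqP k c.
  have := null_all_small_le S c p0P p1P.
  have : \sum_(v in S) bprob (planted p0 p1 S)
      (fun f => c <= #|component_in f [set: V] v|)%N <= a.
    apply: le_trans aP; apply: ler_sum => v _; apply: le_bprob => // f.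
    exact: leq_trans.
  lra.
have : bprob (planted p0 p0 S) (fun f => all_small c f [set: V]) <= b.
  apply: le_trans bP; apply: le_bprob => // f /forall_inP sc.
  by apply/forall_inP => v vV; apply: ltn_trans (sc v vV) ck.
have := bprob_ge0 (fun f => all_small c f [set: V]) qP; lra.
Qed.

End TailsAndRisk.

(** * Choice of the component size for a fixed number of nodes *)

Section FixedSize.
Variable R : realType.

Lemma rate_gt0 (c : R) : 0 < c -> c != 1 -> 0 < rate c.
Proof.
move=> c0 c1; have : 1 + ln c < expR (ln c).
  by apply: expR_gt1Dx; rewrite ln_eq0.
by rewrite lnK ?posrE // /rate; lra.
Qed.

Lemma rate_le (x y : R) : 0 < x -> x <= y -> y <= 1 -> rate y <= rate x.
Proof.
move=> x0 xy y1; have y0 : 0 < y by apply: lt_le_trans xy.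
have := rate_ge0 (divr_gt0 x0 y0); rewrite {1}/rate ln_div ?posrE // => h.
have : (y - x) <= 1 - x / y.
  have -> : 1 - x / y = (y - x) / y by field; rewrite gt_eqF.
  rewrite ler_pdivlMr //.
  by rewrite ler_piMr // subr_ge0.
by rewrite /rate; lra.
Qed.

(** [A] sets the accuracy. As [i0] bounds [rate l0] from below, the relevant [k] are at most
    [4 / i0 * L], and the hypothesis on such [k] makes the powers of [k] and [k n / N] small against
    [ln n]. *)
Lemma powerful_core (N n : nat) (p0 p1 e A i0 : R) :
  let l0 := N%:R * p0 in let l1 := n%:R * p1 in
  let D := l0 + rate l1 - l0 * expR (rate l1) in
  let L := ln N%:R in
  0 < e <= 1 -> 0 <= A -> 0 < l0 < 1 -> 0 <= p1 <= 1 -> 0 < i0 <= rate l0 ->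
  (4 + 2 / e * (1 + A)) * rate l0 <= L -> 2 / e * (1 + A) <= L ->
  (forall k : nat, (0 < k)%N -> k%:R <= 4 / i0 * L ->
    [/\ ln k%:R <= e / 64 * ln n%:R, k%:R * (n%:R / N%:R) <= e / 64 * ln n%:R &
        (k ^ 2 <= n)%N]) ->
  (6 * n <= N)%N -> 16 / 3 / e * (13 + A) <= ln n%:R ->
  1 <= l1 \/ [/\ 0 < l1 <= 1, l0 * expR (rate l1) <= 1 &
    (1 + 3 * e) * (D * L) <= rate l0 * ln n%:R] ->
  risk n p0 p1 (fun G : sgraph N => (1 + e) * (L / rate l0) <=
    (largest_component G)%:R) <= 2 * expR (- A).
Proof.
move=> l0 l1 D L /andP[e0 e1] A0 l0P p1P /andP[i00 iI] HI HL growth nN Hn hyp.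
have I0 : 0 < rate l0 by apply: lt_le_trans iI.
set I := rate l0 in HI iI I0 hyp *; set Q := L / I.
have QI : Q * I = L by rewrite /Q divfK // gt_eqF.
have QB : 4 + 2 / e * (1 + A) <= Q by rewrite ler_pdivlMr.
have e2 : 2 / e * (1 + A) * e = 2 * (1 + A) by field; rewrite gt_eqF.
have eA0 : 0 <= 2 / e * (1 + A) by rewrite mulr_ge0 ?divr_ge0 ?ltW //; lra.
have eQ : 2 * (1 + A) <= Q * e.
  by rewrite -e2; apply: ler_wpM2r; [exact: ltW|lra].
have eL : 2 * (1 + A) <= L * e.
  by rewrite -e2; apply: ler_wpM2r; [exact: ltW|lra].
have lnn : 13 + A <= 3 / 16 * e * ln n%:R.
  have := ler_wpM2l (_ : 0 <= 3 / 16 * e) Hn.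
  have -> : 3 / 16 * e * (16 / 3 / e * (13 + A)) = 13 + A by field; rewrite gt_eqF.
  by apply; rewrite mulr_ge0 ?ltW //; lra.
have [k [kP tk kt]] := nat_threshold ((1 + e) * Q).
have k4' : 4 <= k%:R :> R by apply: le_trans tk; nra.
have k4 : (4 <= k)%N by rewrite -(ler_nat R).
have k0 : (0 < k)%N by apply: leq_trans k4.
(* Rounding up adds at most 1, which is at most [e / 2 * Q]. *)
have {}kt : k%:R <= (1 + 3 / 2 * e) * Q by have := kt k0; lra.
have L0 : 0 < L by nra.
have kC : k%:R <= 4 / i0 * L.
  apply: le_trans kt _; apply: (@le_trans _ _ (4 * Q)); first by nra.
  rewrite mulrAC -mulrA ler_wpM2l // /Q.
  by rewrite ler_wpM2l ?lef_pV2 ?posrE // ltW.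
have [g1 g2 g3] := growth k k0 kC.
(* Of the spare [3 / 8 * e * ln n], one half pays for [13 + A], the other for the two terms with
   factor 6, each at most [6 e / 64 * ln n]. *)
pose kap := (1 - 3 / 8 * e) * ln (n%:R : R).
have lnn0 : 0 <= ln n%:R :> R.
  by rewrite -(pmulr_rge0 _ (_ : 0 < 3 / 16 * e)) ?mulr_gt0 //; lra.
have kap0 : 0 <= kap by rewrite mulr_ge0 //; lra.
apply: le_trans (risk_powerful_le (kap := kap) kP l0P p1P k4 g3 nN _) _.
  case: hyp => [l11|[l1P x1 DL]]; [by left|right; split=> //; split=> //].
  rewrite -/l0 -/l1 -/D; have [D0|D0] := leP D 0.
    by apply: le_trans kap0; rewrite mulr_ge0_le0.
  apply: le_trans (ler_wpM2r (ltW D0) kt) _.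
  have QD : (1 + 3 * e) * (Q * D) <= ln n%:R.
    rewrite -(ler_pM2r I0) [leRHS]mulrC; apply: le_trans DL.
    by apply: ler_eq; rewrite -QI; ring.
  have QD0 : 0 <= Q * D by rewrite mulr_ge0 ?ltW //; lra.
  have -> : (1 + 3 / 2 * e) * Q * D = (1 + 3 / 2 * e) * (Q * D) by ring.
  (* Here [e <= 1] is used: the difference of the factors is [9 / 8 * e * (1 - e)]. *)
  apply: (@le_trans _ _ ((1 - 3 / 8 * e) * (1 + 3 * e) * (Q * D))).
    by apply: ler_wpM2r => //; nra.
  by rewrite -[leLHS]mulrA; apply: ler_wpM2l => //; lra.
have -> : 2 * expR (- A) = expR (- A) + expR (- A) by ring.
rewrite -/l0 -/L -/I; apply: lerD; rewrite ler_expR.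
  have kI : (1 + e) * L <= k%:R * I.
    by rewrite -QI mulrA ler_wpM2r // ltW.
  have : - ln l0 <= I + 1 by rewrite /I /rate; case/andP: l0P; lra.
  have : I <= e / 2 * L by nra.
  nra.
rewrite lerN2; apply: le_trans (expR_ge1Dx _); rewrite /kap; lra.
Qed.

Lemma powerless_core (N n : nat) (p0 p1 e A i0 t : R) :
  let l0 := N%:R * p0 in let l1 := n%:R * p1 in
  let D := l0 + rate l1 - l0 * expR (rate l1) in
  let L := ln N%:R in
  0 < e <= 1 / 4 -> 0 <= A -> 0 < l0 < 1 -> 0 <= p0 <= 1 -> 0 <= p1 <= 1 ->
  0 < i0 <= rate l0 -> 0 < l1 < 1 ->
  (16 / e) * (rate l0) <= L -> 4 / e * (9 + A) <= L -> 8 * (2 + A) <= L ->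
  (forall k : nat, (0 < k)%N -> k%:R <= 4 / i0 * L ->
    [/\ ln k%:R <= e / 16 * ln n%:R, k%:R * (n%:R / N%:R) <= e / 16 * ln n%:R &
        (k ^ 2 <= n)%N]) ->
  (n <= N)%N -> 4 * (n%:R / N%:R) <= i0 -> 2 * ln n%:R <= L ->
  2 / e * (2 + A) <= ln n%:R ->
  l1 * expR (1 - l1) <= l0 \/ [/\ l0 <= l1 * expR (1 - l1), 0 < D &
    rate l0 * ln n%:R <= (1 - 2 * e) * (D * L)] ->
  1 - 2 * expR (- A) <=
  risk n p0 p1 (fun G : sgraph N => t <= (largest_component G)%:R).
Proof.
move=> l0 l1 D L /andP[e0 e1] A0 l0P p0P p1P /andP[i00 iI] l1P.
move=> HI HL HL2 growth nN nNi nL Hn hyp.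
have I0 : 0 < rate l0 by apply: lt_le_trans iI.
have l0' : 0 < l0 by case/andP: l0P.
set I := rate l0 in HI iI I0 hyp *; set Q := L / I.
have QI : Q * I = L by rewrite /Q divfK // gt_eqF.
have QB : 16 / e <= Q by rewrite ler_pdivlMr.
have e16 : 16 / e * e = 16 by rewrite divfK // gt_eqF.
have eQ : 16 <= Q * e by rewrite -e16; apply: ler_wpM2r; [exact: ltW|].
have Q64 : 64 <= Q by nra.
have eI : 16 * I <= e * L by rewrite -QI; nra.
have L0 : 0 < L by nra.
have eL : 4 * (9 + A) <= e * L.
  have := ler_wpM2l (ltW e0) HL.
  by have -> : e * (4 / e * (9 + A)) = 4 * (9 + A) by field; rewrite gt_eqF.
have eln : 2 * (2 + A) <= e * ln n%:R.
  have := ler_wpM2l (ltW e0) Hn.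
  by have -> : e * (2 / e * (2 + A)) = 2 * (2 + A) by field; rewrite gt_eqF.
have lnn0 : 0 < ln n%:R :> R by nra.
have eY : 2 * (e * ln n%:R) <= e * L.
  by have := ler_wpM2l (ltW e0) nL; rewrite mulrCA.
have eY0 : 0 <= e * ln n%:R by rewrite mulr_ge0 ?ltW.
have eL4 : e * L <= 1 / 4 * L by apply: ler_wpM2r; [exact: ltW|].
(* This [k] is independent of the critical value [t]: the null graph has a component of size [k],
   while those meeting [S] are smaller, with high probability. *)
have [k [kP tk kt]] := nat_threshold ((1 - e) * Q).
have k4' : 4 <= k%:R :> R by apply: le_trans tk; nra.
have k4 : (4 <= k)%N by rewrite -(ler_nat R).
have k0 : (0 < k)%N by apply: leq_trans k4.
have {}kt := kt k0.
have kC : k%:R <= 4 / i0 * L.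
  apply: (@le_trans _ _ (4 * Q)); first by nra.
  rewrite mulrAC -mulrA ler_wpM2l // /Q.
  by rewrite ler_wpM2l ?lef_pV2 ?posrE // ltW.
have [g1 g2 g3] := growth k k0 kC.
have [S Sn] : exists S : {set 'I_N}, #|S| = n.
  have : (0 < #|[set S : {set 'I_N} | S \subset [set: 'I_N] & #|S| == n]%SET|)%N.
    by rewrite cards_draws cardsT card_ord bin_gt0.
  by case/card_gt0P => S; rewrite inE => /andP[_ /eqP Sn]; exists S.
have -> : 1 - 2 * expR (- A) = 1 - expR (- A) - expR (- A) by ring.
have eA : expR (- A) <= expR (- A) by [].
apply: (risk_powerless_ge t Sn k0 p0P p1P); last first.
  apply: le_trans (null_all_small_bound S _ k4 _) _.
  - by case/andP: l0P => -> /ltW ->.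
  - exact: leq_trans g3 nN.
  rewrite ler_expR lerN2; apply: le_trans (expR_ge1Dx _); rewrite -/l0 -/I -/L.
  have kI : k%:R * I <= (1 - e) * L + I.
    by rewrite -QI; have := ler_wpM2r (ltW I0) (ltW kt); lra.
  lra.
have kI : (1 - e) * L <= k%:R * I by rewrite -QI mulrA ler_wpM2r // ltW.
case: hyp => [l10|[l01 D0 DL]].
  apply: le_trans (planted_tail_null_regime (S := S) k p0P p1P l0P _ _ _) _;
    rewrite ?Sn -/l1 //.
  - by case/andP: l1P.
  - by apply: le_trans nNi _.
  rewrite ler_expR -/l0 -/I.
  (* The leading terms are [ln n - (1 - e) L <= - L / 4], from [2 ln n <= L] and [e <= 1 / 4]. *)
  have : - ln l0 <= I + 1 by rewrite /I /rate; lra.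
  lra.
(* From [(1 + e) (1 - 2 e) <= 1 - e]. *)
have QD : (1 + e) * ln n%:R <= (1 - e) * (Q * D).
  have h : ln n%:R <= (1 - 2 * e) * (Q * D).
    rewrite -(ler_pM2r I0) [leLHS]mulrC; apply: le_trans DL _.
    by apply: ler_eq; rewrite -QI; ring.
  have QD0 : 0 < Q * D by rewrite mulr_gt0 //; lra.
  have h1 := ler_wpM2l (_ : 0 <= 1 + e) h.
  apply: le_trans (h1 _) _; first by lra.
  by rewrite mulrA; apply: ler_wpM2r; [exact: ltW|nra].
have kD : (1 + e) * ln n%:R <= k%:R * D.
  by apply: le_trans QD _; rewrite mulrA; apply: ler_wpM2r; [exact: ltW|].
have k0' : 0 < k%:R :> R by rewrite ltr0n.
apply: le_trans (planted_tail_mixed_regime (S := S) k p0P p1P l0' _ _ _) _;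
    rewrite ?Sn -/l1 -/l0 -/D //.
- rewrite -(ler_pM2l k0') mulrCA; apply: le_trans kD; lra.
rewrite ler_expR.
(* Thus the extra term [D] is at most [e / 8] of [k D]. *)
have ek : 8 <= e * k%:R.
  have := ler_wpM2l (ltW e0) tk; have := ler_wpM2l (_ : 0 <= 1 - e) eQ.
  by move=> /(_ _)h; have {h} := h _; lra.
have Dk := ler_wpM2r (ltW D0) ek.
have hZ := ler_wpM2l (_ : 0 <= 1 - e / 8) kD; have {}hZ := hZ _.
have e2 : e * (e * ln n%:R) <= 1 / 4 * (e * ln n%:R) by apply: ler_wpM2r.
lra.
Qed.

End FixedSize.

(** * Asymptotics *)

Local Open Scope classical_set_scope.

Section Eventually.
Variable R : realType.

Lemma limn_esup_lt (u : nat -> \bar R) (a : R) : (limn_esup u < a%:E)%E ->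
  exists2 e : R, 0 < e & \forall N \near \oo, (u N <= (a - e)%:E)%E.
Proof.
move=> /ereal_inf_lt[_ [A AF <-]] sA.
have [e e0 sAe] : exists2 e : R, 0 < e & (ereal_sup (u @` A) <= (a - e)%:E)%E.
  move: sA; case: (ereal_sup _) => [r| |] //.
    rewrite lte_fin => ra; exists (a - r); first by rewrite subr_gt0.
    by rewrite lee_fin opprB addrC subrK.
  by move=> _; exists 1; rewrite ?leNye.
exists e => //; apply: filterS AF => N AN; apply: le_trans sAe.
by apply: ereal_sup_ubound; exists N.
Qed.

Lemma limn_einf_gt (u : nat -> \bar R) (a : R) : (a%:E < limn_einf u)%E ->
  exists2 e : R, 0 < e & \forall N \near \oo, ((a + e)%:E <= u N)%E.
Proof.
rewrite /limn_einf lteNr => /limn_esup_lt[e e0 H]; exists e => //.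
by apply: filterS H => N /=; rewrite leeNl -EFinN opprD !opprK.
Qed.

Lemma le_limn_einf (u : nat -> \bar R) (a : R) :
  (forall e : R, 0 < e -> \forall N \near \oo, ((a - e)%:E <= u N)%E) ->
  (a%:E <= limn_einf u)%E.
Proof.
move=> H; rewrite /limn_einf leeNr; apply/lee_addgt0Pr => e e0.
apply: (@le_trans _ _ (ereal_sup ((fun N => - u N)%E @`
   [set N | ((a - e)%:E <= u N)%E]))).
  by apply: ereal_inf_lbound; exists [set N | ((a - e)%:E <= u N)%E]; first exact: H.
apply: ge_ereal_sup => _ [N /= uN <-].
by rewrite -EFinD leeNl -EFinN opprD opprK.
Qed.

Lemma rate_expR (l : R) : 0 < l -> expR (- rate l) = l * expR (1 - l).
Proof.
move=> l0; rewrite -{2}(lnK (x := l)) ?posrE // -expRD; congr expR.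
by rewrite /rate; lra.
Qed.

Lemma mul_expR_rate_le1 (l0 l1 : R) : 0 < l1 ->
  (l0 * expR (rate l1) <= 1) = (l0 <= l1 * expR (1 - l1)).
Proof.
by move=> l1_gt0; rewrite -ler_pdivlMr ?expR_gt0 // div1r -expRN rate_expR.
Qed.

(** With [I = rate l1], the bound [l0 <= e^(- I)] gives [l0 (e^I - 1) <= 1 - e^(- I) <= I]. *)
Lemma threshold_den_ge0 (l0 l1 : R) : 0 < l1 -> l0 <= l1 * expR (1 - l1) ->
  0 <= l0 + rate l1 - l0 * expR (rate l1).
Proof.
move=> l1_gt0 l01; have I1 := rate_ge0 l1_gt0.
have e1 : 1 <= expR (rate l1) by rewrite -expR0 ler_expR.
have : l0 * (expR (rate l1) - 1) <= expR (- rate l1) * (expR (rate l1) - 1).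
  by rewrite ler_wpM2r ?subr_ge0 // rate_expR.
rewrite !mulrBr !mulr1 -expRD addNr expR0.
have := expR_ge1Dx (- rate l1); lra.
Qed.

(** Cross-multiplied, the bound also makes sense for a nonpositive denominator, where the left side
    is at most 0. *)
Lemma threshold_ratio_ge (l0 l1 c : R) (N n : nat) :
  0 <= c -> 0 < rate l0 -> 0 < ln (N%:R : R) -> 0 <= ln (n%:R : R) ->
  (c%:E <= threshold_ratio l0 l1 N n)%E ->
  c * ((l0 + rate l1 - l0 * expR (rate l1)) * ln N%:R) <= rate l0 * ln n%:R.
Proof.
rewrite /threshold_ratio; set D := l0 + _ - _ => c0 I0 L0 ln0.
have [D0|D0] := leP D 0.
  move=> _; apply: (@le_trans _ _ 0).
    by rewrite mulr_ge0_le0 // mulr_le0_ge0 // ltW.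
  by rewrite mulr_ge0 // ltW.
rewrite inver gt_eqF // -!EFinM lee_fin => H.
rewrite mulrA -ler_pdivlMr //; apply: le_trans (ler_wpM2r (ltW D0) H) _.
by apply: ler_eq; field; rewrite !gt_eqF.
Qed.

(** A finite upper bound excludes a zero denominator, for which the ratio is [+oo]. *)
Lemma threshold_ratio_le (l0 l1 c : R) (N n : nat) :
  let D := l0 + rate l1 - l0 * expR (rate l1) in
  0 < rate l0 -> 0 < ln (N%:R : R) -> 0 < ln (n%:R : R) -> 0 <= D ->
  (threshold_ratio l0 l1 N n <= c%:E)%E ->
  0 < D /\ rate l0 * ln n%:R <= c * (D * ln N%:R).
Proof.
move=> D I0 L0 ln0; rewrite le_eqVlt /threshold_ratio -/D => /orP[/eqP <-|D0].
  by rewrite inver eqxx gt0_muley ?lte_fin // gt0_mulye ?lte_fin ?divr_gt0.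
rewrite inver gt_eqF // -!EFinM lee_fin => H; split => //.
rewrite mulrA -ler_pdivrMr // ; apply: le_trans (ler_wpM2r (ltW D0) H).
by apply: ler_eq; field; rewrite !gt_eqF.
Qed.

End Eventually.

(** * Consequences of the growth assumptions *)

Section Asymptotics.
Variables (R : realType) (n : nat -> nat).
Hypothesis n_infty : n @ \oo --> \oo.
Hypothesis n_oN : (fun N => (n N)%:R / N%:R : R) @ \oo --> (0 : R).
Hypothesis loglogN :
  (fun N => ln (ln N%:R) : R) =o_\oo (fun N => ln (n N)%:R : R).

Lemma near_ln_ge (u : nat -> nat) (A : R) : u @ \oo --> \oo ->
  \forall N \near \oo, A <= ln (u N)%:R.
Proof.
move=> /cvgnyPge/(_ (Num.bound (expR A))); apply: filterS => N uN.
have h : expR A <= (u N)%:R.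
  apply: (@le_trans _ _ (Num.bound (expR A))%:R); last by rewrite ler_nat.
  by apply: ltW; apply: archi_boundP; exact: expR_ge0.
rewrite -[leLHS]expRK ler_ln ?posrE ?expR_gt0 //.
exact: lt_le_trans (expR_gt0 _) h.
Qed.

Lemma near_lnN_ge (A : R) : \forall N \near \oo, A <= ln N%:R.
Proof. by apply: (@near_ln_ge id); exact: cvg_id. Qed.

Lemma near_n_le (d : R) : 0 < d -> \forall N \near \oo, (n N)%:R / N%:R <= d.
Proof.
move=> d0; have /cvgr0Pnorm_le/(_ _ d0) := n_oN.
by apply: filterS => N; apply: le_trans; exact: ler_norm.
Qed.

(** For [k = O(log N)], [ln k] is [log log N] up to a constant, hence [o(log n)]; capping [d] at
    [1 / 2] also yields [k ^ 2 <= n]. *)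
Lemma near_growth (C d : R) : 0 < C -> 0 < d ->
  \forall N \near \oo, forall k : nat, (0 < k)%N -> k%:R <= C * ln N%:R ->
    [/\ ln k%:R <= d * ln (n N)%:R,
        k%:R * ((n N)%:R / N%:R) <= d * ln (n N)%:R & (k ^ 2 <= n N)%N].
Proof.
move=> C0 d0; pose d' := Num.min d (1 / 2).
have d'0 : 0 < d' by rewrite lt_min d0 /=; lra.
have d'd : d' <= d by rewrite ge_min lexx.
have d'2 : d' <= 1 / 2 by rewrite ge_min lexx orbT.
have hd : 0 < d' / 2 by rewrite divr_gt0.
have hC : 0 < d / (2 * C) by rewrite divr_gt0 // mulr_gt0.
near=> N; move=> k k0 kC.
have lnn : 1 + `|ln C| / (d' / 2) + 2 * C / d <= ln (n N)%:R.
  by near: N; exact: near_ln_ge.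
have a0 : 0 <= `|ln C| / (d' / 2) by rewrite divr_ge0 // ltW.
have a1 : 0 <= 2 * C / d by rewrite divr_ge0 ?mulr_ge0 // ltW.
have lnn0 : 0 < ln (n N)%:R :> R by lra.
have L1 : 1 <= ln N%:R :> R by near: N; exact: near_lnN_ge.
have nN : (n N)%:R / N%:R <= d / (2 * C) by near: N; exact: near_n_le.
have ll : `|ln (ln N%:R)| <= d' / 2 * `|ln (n N)%:R|.
  by near: N; move/eqoP: loglogN; apply.
have n1 : 1 < (n N)%:R :> R.
  by rewrite ltNge; apply/negP => /ln_le0; lra.
have N1 : 1 < N%:R :> R by rewrite ltNge; apply/negP => /ln_le0; lra.
have k0' : 0 < k%:R :> R by rewrite ltr0n.
have lk : ln k%:R <= d' * ln (n N)%:R.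
  have : ln k%:R <= ln (C * ln N%:R) by rewrite ler_ln ?posrE // mulr_gt0 //; lra.
  rewrite lnM ?posrE //; last by lra.
  move: ll; rewrite (gtr0_norm lnn0) => ll.
  have := ler_norm (ln C); have := ler_norm (ln (ln N%:R : R)).
  have : `|ln C| <= d' / 2 * ln (n N)%:R.
    by rewrite mulrC -ler_pdivrMr //; lra.
  lra.
split.
- by apply: le_trans lk _; rewrite ler_wpM2r // ltW.
- have q0 : 0 <= (n N)%:R / N%:R :> R by rewrite divr_ge0.
  apply: le_trans (ler_wpM2r q0 kC) _.
  (* If [n ^ 2 <= N], then [ln N <= 2 sqrt N] bounds [ln N * n / N] by 2; otherwise
     [ln N <= 2 ln n], and [n / N] is small. *)
  have [nsq|nsq] := leP ((n N)%:R ^+ 2) (N%:R : R).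
    have s0 := sqrtr_ge0 (N%:R : R).
    have s1 : Num.sqrt (N%:R) ^+ 2 = N%:R :> R by rewrite sqr_sqrtr.
    have sp : 0 < Num.sqrt (N%:R : R) by rewrite sqrtr_gt0; lra.
    have ns : (n N)%:R <= Num.sqrt (N%:R : R).
      by rewrite -(@ler_pXn2r _ 2) ?nnegrE // s1.
    have Ls : ln N%:R <= 2 * Num.sqrt (N%:R : R).
      rewrite -[in leLHS]s1 lnXn // -[leLHS]mulr_natl; apply: ler_wpM2l => //.
      by have := rate_ge0 sp; rewrite /rate; lra.
    have h : ln N%:R * ((n N)%:R / N%:R) <= 2 :> R.
      rewrite mulrA ler_pdivrMr; last by lra.
      by rewrite -[in leRHS]s1 expr2 mulrA; apply: ler_pM => //; lra.
    rewrite -mulrA; apply: le_trans (ler_wpM2l (ltW C0) h) _.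
    by rewrite mulrC [leRHS]mulrC -ler_pdivrMr //; lra.
  have lnN : ln N%:R <= 2 * ln (n N)%:R :> R.
    rewrite mulr_natl -lnXn; last by lra.
    by rewrite ler_ln ?posrE ?exprn_gt0 ?ltW //; lra.
  apply: (@le_trans _ _ (C * (2 * ln (n N)%:R) * (d / (2 * C)))).
    apply: ler_pM => //; first by rewrite mulr_ge0 ?ltW //; lra.
    by rewrite ler_wpM2l // ltW.
  by apply: ler_eq; field; rewrite gt_eqF.
- rewrite -(ler_nat R) natrX -ler_ln ?posrE ?exprn_gt0 //; last by lra.
  rewrite lnXn // -[leLHS]mulr_natl.
  have : d' * ln (n N)%:R <= 1 / 2 * ln (n N)%:R by rewrite ler_wpM2r // ltW.
  lra.
Unshelve. all: by end_near.
Qed.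

End Asymptotics.

Lemma risk_ge0 (R : realType) (N n : nat) (p0 p1 : R) (phi : sgraph N -> bool) :
  0 <= p0 <= 1 -> 0 <= risk n p0 p1 phi.
Proof.
move=> p0P; apply: addr_ge0.
  by rewrite (null_prE p0 set0); apply/bprob_ge0/planted_prob.
by elim/big_rec: _ => // S x _ x0; rewrite le_max x0 orbT.
Qed.

Lemma exists_expRN_le (R : realType) (eps : R) : 0 < eps ->
  exists2 A : R, 0 <= A & 2 * expR (- A) <= eps.
Proof.
move=> eps0; exists (Num.max 0 (- ln (eps / 2))); first by rewrite le_max lexx.
rewrite mulrC -ler_pdivlMr // -[leRHS]lnK ?posrE ?divr_gt0 //.
by rewrite ler_expR lerNl le_max lexx orbT.
Qed.

Theorem theorem2 (R : realType) (n : nat -> nat) (p0 p1 : nat -> R)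
    (p0_ge0 : forall N, 0 <= p0 N)
    (p0_lt_p1 : forall N, p0 N < p1 N)
    (p1_le1 : forall N, p1 N <= 1)
    (n_infty : n @ \oo --> \oo)
    (n_oN : (fun N => (n N)%:R / N%:R : R) @ \oo --> (0 : R))
    (n_logN : (fun N => (n N)%:R / ln N%:R : R) @ \oo --> +oo)
    (N2p0 : (fun N => N%:R ^+ 2 * p0 N) @ \oo --> +oo)
    (n2p1 : (fun N => (n N)%:R ^+ 2 * p1 N) @ \oo --> +oo)
    (loglogN : (fun N => ln (ln N%:R) : R) =o_\oo (fun N => ln (n N)%:R : R)) :
  let l0 := fun N => N%:R * p0 N in
  let l1 := fun N => (n N)%:R * p1 N in
  let T := fun N (G : sgraph N) => (largest_component G)%:R : R in
  let ratio := fun N => threshold_ratio (l0 N) (l1 N) N (n N) in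
  (limn_esup (fun N => (l0 N)%:E) < 1%:E)%E ->
  (fun N => (rate (l0 N))^-1 * ln N%:R) @ \oo --> +oo ->
  ((1%:E < limn_einf (fun N => (l1 N)%:E))%E \/
     ((\forall N \near \oo, l0 N <= l1 N * expR (1 - l1 N)) /\
      (1%:E < limn_einf ratio)%E) ->
   asymptotically_powerful n p0 p1 T) /\
  ((fun N => (n N)%:R ^+ 2 : R) =o_\oo (fun N => N%:R : R) ->
   (forall N, l1 N < 1) ->
   (\forall N \near \oo, l0 N >= l1 N * expR (1 - l1 N)) \/
     (limn_esup ratio < 1%:E)%E ->
   asymptotically_powerless n p0 p1 T).
Proof.
move=> l0 l1 T ratio /limn_esup_lt[d d0 l0d] rate_lim.
have p1_gt0 N : 0 < p1 N by apply: le_lt_trans (p0_lt_p1 N).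
have p1P N : 0 <= p1 N <= 1 by rewrite ltW /=.
have p0P N : 0 <= p0 N <= 1 by rewrite p0_ge0 (le_trans (ltW (p0_lt_p1 N))).
(* An eventual bound of [l0] below 1; the maximum keeps it positive, so that [rate c] is a positive
   lower bound for [rate (l0 N)]. *)
pose c := Num.max (1 - d) (1 / 2).
have c0 : 0 < c by rewrite lt_max; apply/orP; right; lra.
have c1 : c < 1 by rewrite gt_max; apply/andP; split; lra.
have i0_gt0 : 0 < rate c by apply: rate_gt0; rewrite ?lt_eqF.
pose i0 := rate c.
have l0P : \forall N \near \oo, 0 < l0 N < 1 /\ 0 < i0 <= rate (l0 N).
  near=> N.
  have l0c : l0 N <= c.
    have : ((l0 N)%:E <= (1 - d)%:E)%E by near: N.
    by rewrite lee_fin le_max => ->.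
  have Np : 1 <= N%:R ^+ 2 * p0 N by near: N; move/cvgryPge: N2p0; apply.
  have l0_gt0 : 0 < l0 N.
    rewrite lt0r mulr_ge0 // andbT; apply/eqP => l00.
    by move: Np; rewrite expr2 -mulrA -/(l0 N) l00 mulr0 ler10.
  by rewrite l0_gt0 i0_gt0 (le_lt_trans l0c) // rate_le // ltW.
have I0_small (B : R) : \forall N \near \oo, B * rate (l0 N) <= ln N%:R.
  have /cvgryPge/(_ B) := rate_lim; apply: filterS2 l0P => N [_ /andP[i0' iI]].
  by rewrite mulrC ler_pdivlMr // (lt_le_trans i0').
have C0 : 0 < 4 / i0 by rewrite divr_gt0.
have n_gt1 : \forall N \near \oo, 0 < ln (n N)%:R :> R.
  by apply: filterS (near_ln_ge 1 n_infty) => N; apply: lt_le_trans.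
have n_gt0 N : 0 < ln (n N)%:R :> R -> 0 < (n N)%:R :> R.
  by move=> h; rewrite ltNge; apply/negP => /ln0 h'; rewrite h' ltxx in h.
have L_gt0 : \forall N \near \oo, 0 < ln N%:R :> R.
  by apply: filterS (near_lnN_ge 1) => N; apply: lt_le_trans.
split.
  move=> hyp.
  have [e eP disj] : exists2 e : R, 0 < e <= 1 & \forall N \near \oo,
      1 <= l1 N \/ [/\ 0 < l1 N <= 1, l0 N * expR (rate (l1 N)) <= 1 &
      (1 + 3 * e) * ((l0 N + rate (l1 N) - l0 N * expR (rate (l1 N))) * ln N%:R)
        <= rate (l0 N) * ln (n N)%:R].
    case: hyp => [/limn_einf_gt[e e0 He]|[l01 /limn_einf_gt[e e0 He]]].
      exists 1; first by rewrite ltr01 lexx.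
      by apply: filterS He => N; rewrite lee_fin => h; left; lra.
    (* The margin [1 + e] has to cover [1 + 3 e'] for the new constant [e']. *)
    exists (Num.min 1 (e / 3)).
      by rewrite lt_min ltr01 divr_gt0 //= ge_min lexx.
    near=> N; have [l11|l11] := leP 1 (l1 N); first by left.
    have lnn : 0 < ln (n N)%:R :> R by near: N.
    have L0 : 0 < ln N%:R :> R by near: N.
    have l10 : 0 < l1 N by rewrite mulr_gt0 ?n_gt0.
    have [_ /andP[i0' iI]] : 0 < l0 N < 1 /\ 0 < i0 <= rate (l0 N) by near: N.
    right; split; first by rewrite l10 ltW.
      by rewrite mul_expR_rate_le1 //; near: N.
    apply: threshold_ratio_ge => //; last 2 first.
    - exact: ltW.
    - have : ((1 + e)%:E <= ratio N)%E by near: N.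
      apply: le_trans; rewrite lee_fin lerD2l.
      have : Num.min 1 (e / 3) <= e / 3 by rewrite ge_min lexx orbT.
      lra.
    - have : 0 <= Num.min 1 (e / 3) by rewrite le_min ler01 divr_ge0 ?ltW.
      lra.
    - exact: lt_le_trans iI.
  case/andP: (eP) => e0 e1.
  exists (fun N => (1 + e) * (ln N%:R / rate (l0 N))).
  apply/cvgr0Pnorm_le => eps /exists_expRN_le[A A0 Aeps].
  have h64 : 0 < e / 64 by rewrite divr_gt0.
  near=> N; rewrite ger0_norm ?risk_ge0 //; apply: le_trans Aeps.
  have [l0N iN] : 0 < l0 N < 1 /\ 0 < i0 <= rate (l0 N) by near: N.
  apply: (powerful_core (i0 := i0)) => //.
  - by near: N; exact: I0_small.
  - by near: N; exact: near_lnN_ge.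
  - by near: N; exact: near_growth.
  - have N0 : 0 < N%:R :> R.
      have L0 : 0 < ln N%:R :> R by near: N.
      by rewrite ltNge; apply/negP => /ln0 h'; rewrite h' ltxx in L0.
    have : (n N)%:R / N%:R <= 1 / 6 :> R by near: N; apply: near_n_le => //; lra.
    rewrite ler_pdivrMr // -(ler_nat R) natrM; lra.
  - by near: N; exact: near_ln_ge.
  - by near: N.
move=> n2N l1_lt1 hyp t.
have [e eP disj] : exists2 e : R, 0 < e <= 1 / 4 & \forall N \near \oo,
    l1 N * expR (1 - l1 N) <= l0 N \/ [/\ l0 N <= l1 N * expR (1 - l1 N),
      0 < l0 N + rate (l1 N) - l0 N * expR (rate (l1 N)) &
      rate (l0 N) * ln (n N)%:R <= (1 - 2 * e) *
      ((l0 N + rate (l1 N) - l0 N * expR (rate (l1 N))) * ln N%:R)].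
  case: hyp => [l10|/limn_esup_lt[e e0 He]].
    exists (1 / 4); first by apply/andP; split; lra.
    by apply: filterS l10 => N; left.
  exists (Num.min (1 / 4) (e / 2)).
    rewrite lt_min divr_gt0 //= ge_min lexx !andbT; lra.
  near=> N.
  (* The regime may change with [N]; the ratio is used only in the mixed regime, where its
     denominator is nonnegative. *)
  have [l10|/ltW l01] := leP (l1 N * expR (1 - l1 N)) (l0 N); [by left|right].
  have lnn : 0 < ln (n N)%:R :> R by near: N.
  have L0 : 0 < ln N%:R :> R by near: N.
  have l10 : 0 < l1 N by rewrite mulr_gt0 ?n_gt0.
  have [_ /andP[i0' iI]] : 0 < l0 N < 1 /\ 0 < i0 <= rate (l0 N) by near: N.
  have [] := @threshold_ratio_le R (l0 N) (l1 N) (1 - 2 * Num.min (1 / 4) (e / 2))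
    N (n N) (lt_le_trans i0' iI) L0 lnn (threshold_den_ge0 l10 l01); last by split.
  have : (ratio N <= (1 - e)%:E)%E by near: N.
  move/le_trans; apply; rewrite lee_fin.
  have : Num.min (1 / 4) (e / 2) <= e / 2 by rewrite ge_min lexx orbT.
  lra.
case/andP: (eP) => e0 e1.
apply: le_limn_einf => eps /exists_expRN_le[A A0 Aeps].
have h16 : 0 < e / 16 by rewrite divr_gt0.
near=> N; rewrite lee_fin.
have [l0N iN] : 0 < l0 N < 1 /\ 0 < i0 <= rate (l0 N) by near: N.
have lnn : 0 < ln (n N)%:R :> R by near: N.
have L0 : 0 < ln N%:R :> R by near: N.
have n0 := n_gt0 N lnn.
have N0 : 0 < N%:R :> R.
  by rewrite ltNge; apply/negP => /ln0 h'; rewrite h' ltxx in L0.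
apply: (@le_trans _ _ (1 - 2 * expR (- A))); first by rewrite lerD2l lerN2.
apply: (powerless_core (e := e) (i0 := i0)) => //.
- by rewrite l1_lt1 mulr_gt0.
- by near: N; exact: I0_small.
- by near: N; exact: near_lnN_ge.
- by near: N; exact: near_lnN_ge.
- by near: N; exact: near_growth.
- have : (n N)%:R / N%:R <= 1 :> R by near: N; apply: near_n_le.
  by rewrite ler_pdivrMr // mul1r ler_nat.
- have : (n N)%:R / N%:R <= i0 / 4 by near: N; apply: near_n_le => //; rewrite divr_gt0.
  lra.
- have : `|(n N)%:R ^+ 2| <= 1 * `|N%:R : R|.
    by near: N; move/eqoP: n2N; apply.
  rewrite mul1r !ger0_norm ?sqr_ge0 // => n2.
  by rewrite mulr_natl -lnXn // ler_ln ?posrE ?exprn_gt0.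
- by near: N; exact: near_ln_ge.
- by near: N.
Unshelve. all: by end_near.
Qed.
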